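(* Let $d\in\mathbb N$ and let $\omega^{(1)},\dots,\omega^{(d)}$ be $d$ i.i.d. random environments, each of which is an i.i.d. sequence $\omega=(\omega_x)_{x\in\mathbb Z}$ satisfying $\mathbb E[\log\rho_0]=0$, $\operatorname{Var}(\log\rho_0)>0$ (where $\rho_0=\frac{1-\omega_0}{\omega_0}$), and $\mathbb P(\varepsilon\le\omega_0\le 1-\varepsilon)=1$ for some $\varepsilon\in(0,\tfrac12)$. Then for $\mathbb P^{\otimes d}$-a.e. $(\omega^{(1)},\dots,\omega^{(d)})$, $$\sum_{n\in\mathbb N}\prod_{k=1}^{d}P_{\omega^{(k)}}(X_{2n}=0)=\infty .$$ In particular, for $\mathbb P^{\otimes d}$-a.e. $(\omega^{(1)},\dots,\omega^{(d)})$, if $X^{(1)},\dots,X^{(d)}$ are independent walks, $X^{(k)}$ having law $P_{\omega^{(k)}}$ (all started from the origin), then almost surely there are infinitely many $n$ with $X^{(1)}_n=\dots=X^{(d)}_n=0$.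
   Context: An environment is a sequence $\omega=(\omega_x)_{x\in\mathbb Z}$ of i.i.d. random variables with values in $(0,1)$ defined on a probability space $(\Omega,\mathcal F,\mathbb P)$; $\mathbb E$ and $\operatorname{Var}$ refer to $\mathbb P$; $\mathbb P^{\otimes d}$ is the $d$-fold product measure governing $d$ independent copies of the environment. Given $\omega$, under $P_\omega$ the process $(X_n)_{n\ge0}$ is a Markov chain on $\mathbb Z$ with $P_\omega(X_0=0)=1$ and $P_\omega(X_{n+1}=x+1\mid X_n=x)=\omega_x=1-P_\omega(X_{n+1}=x-1\mid X_n=x)$. $\mathbb N=\{1,2,\dots\}$. *)

(* Defs.v *)
From HB Require Import structures.
From mathcomp Require Import all_boot all_order all_algebra finmap zify ring lra.
From mathcomp Require Import all_classical all_reals all_analysis.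
From mathcomp Require Import measurable_realfun.
Set Implicit Arguments.
Unset Strict Implicit.
Unset Printing Implicit Defensive.
Import Order.TTheory GRing.Theory Num.Theory.
Import numFieldNormedType.Exports.
Local Open Scope classical_set_scope.
Local Open Scope ring_scope.

HB.instance Definition _ := isPointed.Build int 0.
HB.instance Definition _ := @isMeasurable.Build default_measure_display
  int discrete_measurable discrete_measurable0
  discrete_measurableC discrete_measurableU.

Section independence.
Context d (T : measurableType d) (R : realType) (P : probability T R).

Definition mutually_independent (I : choiceType) (G : I -> set (set T)) :=
  forall (J : {fset I}) (A : I -> set T),
    (forall i, i \in J -> G i (A i)) ->
    P (\bigcap_(i in [set` J]) A i) = (\prod_(i <- J) P (A i))%E.

Definition independent_RVs d' (T' : measurableType d') (I : choiceType)
    (X : I -> {RV P >-> T'}) :=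
  mutually_independent (fun i => g_sigma_algebra_preimage (X i)).

Definition independent_processes d' (T' : measurableType d') (I : choiceType)
    (X : I -> nat -> {RV P >-> T'}) :=
  mutually_independent
    (fun i => <<s \bigcup_n g_sigma_algebra_preimage (X i n) >>).

(* The laws are compared on measurable sets only: [distribution] also assigns
   a (junk) value to the other ones. *)
Definition iid d' (T' : measurableType d') (I : choiceType)
    (X : I -> {RV P >-> T'}) :=
  independent_RVs X /\
  forall i j (A : set T'), measurable A ->
    distribution P (X i) A = distribution P (X j) A.

End independence.

Section product_probability.
Context d (T : measurableType d) (R : realType) (P : probability T R).

Definition tuple_cons n (x : T * n.-tuple T) : n.+1.-tuple T :=
  [the n.+1.-tuple T of x.1 :: x.2].

Lemma measurable_tuple_cons n : measurable_fun setT (@tuple_cons n).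
Proof.
apply: (@measurable_cons _ _ _ _ (@fst T (n.-tuple T)) n
  (@snd T (n.-tuple T))) => //.
Qed.

HB.instance Definition _ n :=
  isMeasurableFun.Build _ _ _ _ (@tuple_cons n) (@measurable_tuple_cons n).

(* The n-fold product P^{(x) n} on the product sigma-algebra of [n.-tuple T];
   its value on rectangles is given by [product_probE]. *)
Fixpoint product_prob n : probability (n.-tuple T) R :=
  if n is m.+1 then
    distribution (P \x product_prob m)%E (@tuple_cons m)
  else \d_([tuple] : 0.-tuple T).

Lemma product_probE n (A : 'I_n -> set T) : (forall i, measurable (A i)) ->
  product_prob n [set t | forall i, A i (tnth t i)] =
  (\prod_(i < n) P (A i))%E.
Proof.
elim: n A => [A _|n IH A mA].
  rewrite big_ord0 /= (_ : [set _ | _] = setT) ?probability_setT//.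
  by apply/seteqP; split => // t _ [].
rewrite big_ord_recl -IH//= /distribution /pushforward.
rewrite -product_measure1E//; last first.
  rewrite (_ : [set _ | _] =
    \bigcap_(i : 'I_n) (@tnth n T ^~ i) @^-1` A (lift ord0 i)).
    apply: fin_bigcap_measurable => // i _; rewrite -[X in measurable X]setTI.
    exact: measurable_tnth.
  by apply/seteqP; split => [t h i _|t h i]; exact: h.
congr (_ _); apply/seteqP; split => [[x t]/= h|[x t] [/= Ax h] i].
  split; first by have := h ord0; rewrite tnth0.
  by move=> i; have := h (lift ord0 i); rewrite tnthS.
by case: (unliftP ord0 i) => [j|] ->; rewrite ?tnth0// tnthS.
Qed.

End product_probability.

Section rwre.
Context (R : realType).

Definition rho (p : R) : R := (1 - p) / p.

Definition jump (om : int -> R) (x y : int) : R :=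
  if y == x + 1 then om x else if y == x - 1 then 1 - om x else 0.

(* The Markov property is written without conditional probabilities, so that
   trajectories of probability zero need no separate treatment. *)
Definition is_rwre (om : int -> R) d (T : measurableType d)
    (Q : probability T R) (X : nat -> {RV Q >-> int}) :=
  Q [set t | X 0%N t = 0] = 1%E /\
  forall n (x : nat -> int),
    Q [set t | forall i, (i <= n.+1)%N -> X i t = x i] =
    (Q [set t | forall i, (i <= n)%N -> X i t = x i] *
     (jump om (x n) (x n.+1))%:E)%E.

(* [is_rwre] is realizable, also by independent walks in given environments
   ([rwre_exists]): a uniform u in [0, 1[ encodes the successive jumps. At x the
   walk jumps right iff u < om x; the position of u in the selected piece of
   [0, 1[, rescaled to [0, 1[, is used for the next jump. *)
Section existence.

Let step (om : int -> R) (s : int * R) : int * R :=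
  if s.2 < om s.1 then (s.1 + 1, s.2 / om s.1)
  else (s.1 - 1, (s.2 - om s.1) / (1 - om s.1)).

Let state om n (u : R) := iter n (step om) (0, u).

Let measurable_comp_int (f : int -> R) (g : R -> int) :
  measurable_fun setT g -> measurable_fun setT (fun u => f (g u)).
Proof. by move=> mg; apply: (@measurableT_comp _ _ _ _ _ _ f). Qed.

Let measurable_state om n : measurable_fun setT (fun u => (state om n u).1) /\
  measurable_fun setT (fun u => (state om n u).2).
Proof.
elim: n => [|n [m1 m2]]; first by split; [exact: measurable_cst|exact: measurable_id].
have mb : measurable_fun setT
    (fun u => (state om n u).2 < om (state om n u).1).
  by apply: measurable_fun_ltr => //; exact: measurable_comp_int.
have E u : state om n.+1 u = step om (state om n u) by [].
split.
- rewrite (_ : (fun _ => _) = fun u =>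
    if (state om n u).2 < om (state om n u).1
    then (fun z : int => z + 1) (state om n u).1
    else (fun z : int => z - 1) (state om n u).1); last first.
    by apply/funext => u; rewrite E /step; case: ifP.
  apply: measurable_fun_ifT => //.
  + exact: (@measurableT_comp _ _ _ _ _ _ (fun z : int => z + 1)).
  + exact: (@measurableT_comp _ _ _ _ _ _ (fun z : int => z - 1)).
- rewrite (_ : (fun _ => _) = fun u =>
    if (state om n u).2 < om (state om n u).1
    then (state om n u).2 * (om (state om n u).1)^-1
    else ((state om n u).2 - om (state om n u).1)
      * (1 - om (state om n u).1)^-1); last first.
    by apply/funext => u; rewrite E /step; case: ifP.
  apply: measurable_fun_ifT => //.
  + apply: measurable_funM => //.
    exact: (measurable_comp_int (fun z => (om z)^-1)).
  + apply: measurable_funM.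
      by apply: measurable_funB => //; exact: measurable_comp_int.
    exact: (measurable_comp_int (fun z => (1 - om z)^-1)).
Qed.

Let path_weight om (x : nat -> int) n : R :=
  (x 0%N == 0)%:R * \prod_(i < n) jump om (x i) (x i.+1).

Let path_event om (x : nat -> int) n :=
  [set u | forall i, (i <= n)%N -> (state om i u).1 = x i].

Let path_eventS om x n : path_event om x n.+1 =
  path_event om x n `&` [set u | (state om n.+1 u).1 = x n.+1].
Proof.
apply/seteqP; split => [u h|u [h1 h2] i].
  by split => [i iN|]; apply: h => //; exact: leqW.
by rewrite leq_eqVlt => /orP[/eqP ->//|]; rewrite ltnS; exact: h1.
Qed.

Let path_event_itv om (om01 : forall x, 0 < om x < 1) x n :
  0 <= path_weight om x n /\ exists a : R,
    path_event om x n `&` [set` `[0, 1[] =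
      [set` `[a, a + path_weight om x n[] /\
    forall u, (path_event om x n `&` [set` `[0, 1[]) u ->
      (state om n u).2 * path_weight om x n = u - a.
Proof.
elim: n => [|n [l0 [a [Ea Ha]]]].
  rewrite /path_weight big_ord0 mulr1; split => //; exists 0.
  rewrite /path_event add0r; case: eqP => x0.
    split => [|u _]; last by rewrite /= mulr1 subr0.
    apply/seteqP; split => [u []//|u u01]; split => // -[]//=.
  split; first by rewrite set_itvxx; apply/seteqP; split => // u [/(_ 0%N isT)/= /esym].
  by move=> u [/(_ 0%N isT)/= /esym].
have w : path_weight om x n.+1 = path_weight om x n * jump om (x n) (x n.+1).
  by rewrite /path_weight big_ord_recr /= mulrA.
rewrite w path_eventS -setIA (setIC _ [set` _]) setIA.
set l := path_weight om x n in l0 Ea Ha *.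
set F := _ `&` [set` `[0, 1[] in Ea Ha *.
have [p0 p1] := andP (om01 (x n)).
have q0 : 0 < 1 - om (x n) by rewrite subr_gt0.
have j0 : 0 <= jump om (x n) (x n.+1).
  by rewrite /jump; case: ifP => _; [exact: ltW|case: ifP => _ //; exact: ltW].
split; first exact: mulr_ge0.
have FS u : F u -> state om n.+1 u =
    if (state om n u).2 < om (x n) then (x n + 1, (state om n u).2 / om (x n))
    else (x n - 1, ((state om n u).2 - om (x n)) / (1 - om (x n))).
  by move=> [/(_ n (leqnn n)) <- _].
have Fl u : F u -> a <= u < a + l by rewrite Ea /= in_itv.
have l_gt0 u : F u -> 0 < l.
  by move=> /Fl/andP[au ul]; rewrite -(ltrD2l a) addr0 (le_lt_trans au).
have cutE u : F u -> ((state om n u).2 < om (x n)) = (u < a + l * om (x n)).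
  move=> Fu; rewrite -(ltr_pM2r (l_gt0 _ Fu)) Ha// mulrC.
  by rewrite ltrBlDl.
rewrite /jump; case: eqP => [xS|xS1].
  exists a; split.
    apply/seteqP; split=> [u [Fu Su]|u /=].
      rewrite /= in_itv/= (andP (Fl _ Fu)).1/= -cutE//.
      move: Su; rewrite /mkset FS//; case: ifP => //= _; rewrite xS => /addrI; lia.
    rewrite in_itv/= => /andP[au ul].
    have Fu : F u.
      rewrite Ea /= in_itv/= au (lt_le_trans ul)// lerD2l ler_piMr//.
      exact: ltW.
    split => //; change ((state om n.+1 u).1 = x n.+1);
        by rewrite FS// cutE// ul.
  move=> u [Fu Su]; rewrite -Ha//.
  move: Su; rewrite /mkset FS//; case: ifP => //= _; last by rewrite xS => /addrI; lia.
  by move=> _; field; rewrite gt_eqF.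
case: eqP => [xS|xS2].
  exists (a + l * om (x n)).
  have aE : a + l * om (x n) + l * (1 - om (x n)) = a + l by ring.
  rewrite aE; split.
    apply/seteqP; split=> [u [Fu Su]|u /=].
      rewrite /= in_itv/= (andP (Fl _ Fu)).2 andbT leNgt -cutE//.
      move: Su; rewrite /mkset FS//; case: ifP => //= _; rewrite xS => /addrI; lia.
    rewrite in_itv/= => /andP[au ul].
    have Fu : F u.
      rewrite Ea /= in_itv/= ul andbT (le_trans _ au)// lerDl mulr_ge0//.
      exact: ltW.
    split => //; change ((state om n.+1 u).1 = x n.+1);
        by rewrite FS// cutE// ltNge au/=.
  move=> u [Fu Su]; rewrite opprD addrA -Ha//.
  move: Su; rewrite /mkset FS//; case: ifP => //= _; first by rewrite xS => /addrI; lia.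
  by move=> _; field; rewrite gt_eqF.
exists a; rewrite mulr0 addr0 set_itvxx.
have N u : ~ (F `&` [set u | (state om n.+1 u).1 = x n.+1]) u.
  by move=> [Fu]; rewrite /mkset FS//; case: ifP => _ /= /esym.
by split => [|u /N//]; apply/seteqP; split => // u /N.
Qed.

Let U : probability (measurableTypeR R) R := uniform_prob (@ltr01 R).

Let U_itv (B : set R) : measurable B -> B `<=` [set` `[0, 1[] ->
  U B = lebesgue_measure B.
Proof.
move=> mB B01; rewrite /U /= /uniform_prob.
rewrite (eq_integral (fun=> 1%E)).
  by rewrite integral_cst// mul1e.
move=> u /[!inE] /B01; rewrite /= in_itv/= => /andP[u0 u1].
by rewrite /uniform_pdf u0 (ltW u1)/= subr0 invr1.
Qed.

Let measurable_path_event om x n : measurable (path_event om x n).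
Proof.
rewrite (_ : path_event om x n = \bigcap_(i in [set i | (i <= n)%N])
    (fun u => (state om i u).1) @^-1` [set x i]); last first.
  by apply/seteqP; split => u h i; exact: h.
apply: bigcap_measurableType => i _; rewrite -[X in measurable X]setTI.
exact: (measurable_state om i).1.
Qed.

Let path_event_prob om (om01 : forall x, 0 < om x < 1) x n :
  U (path_event om x n) = (path_weight om x n)%:E.
Proof.
have [l0 [a [E _]]] := path_event_itv om01 x n.
have mI : measurable ([set` `[0, 1[] : set (measurableTypeR R)).
  exact: measurable_itv.
have mC := measurableC mI.
have UI : U [set` `[0, 1[] = 1%E.
  rewrite U_itv// lebesgue_measure_itv/= lte_fin ltr01.
  by rewrite -EFinB subr0.
have mE : measurable (path_event om x n `&` [set` `[0, 1[]).
  exact: measurableI.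
have mEC : measurable (path_event om x n `&` ~` [set` `[0, 1[]).
  exact: measurableI.
have U0 : U (path_event om x n `&` ~` [set` `[0, 1[]) = 0%E.
  apply/eqP; rewrite -measure_le0 -(_ : U (~` [set` `[0, 1[]) = 0%E).
    by apply: le_measure; rewrite ?inE//; exact: subIsetr.
  by rewrite probability_setC// UI subee.
rewrite -[in LHS](setIT (path_event om x n)) -(setUv [set` `[0, 1[]) setIUr.
rewrite measureU0//.
apply: (eq_trans (U_itv mE (@subIsetr _ _ _))); rewrite E.
rewrite lebesgue_measure_itv/= lte_fin ltrDl; case: ltP => [_|l0'].
  by rewrite -EFinB addrAC subrr add0r.
by congr (_%:E); apply/eqP; rewrite eq_le l0 l0'.
Qed.

Let Omega (d : nat) := d.-tuple (measurableTypeR R).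

Let walk d (om : 'I_d -> int -> R) k n (t : Omega d) : int :=
  (state (om k) n (tnth t k)).1.

Let measurable_walk d (om : 'I_d -> int -> R) k n :
  measurable_fun setT (@walk d om k n).
Proof.
apply: (@measurableT_comp _ _ _ _ _ _ (fun u => (state (om k) n u).1)).
  exact: (measurable_state _ _).1.
exact: measurable_tnth.
Qed.

HB.instance Definition _ d (om : 'I_d -> int -> R) k n :=
  isMeasurableFun.Build _ _ _ _ (@walk d om k n) (@measurable_walk d om k n).

Lemma rwre_exists d (om : 'I_d -> int -> R) :
  (forall k x, 0 < om k x < 1) ->
  exists (dT : measure_display) (T : measurableType dT) (Q : probability T R)
    (X : 'I_d -> nat -> {RV Q >-> int}),
    (forall k, is_rwre (om k) (X k)) /\ independent_processes X.
Proof.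
move=> om01; pose Q := product_prob U d.
exists _, (Omega d), Q, (fun k n => @walk d om k n).
have QE k (A : set R) : measurable A ->
    Q ((fun t : Omega d => tnth t k) @^-1` A) = U A.
  move=> mA; pose B i : set R := if i == k then A else setT.
  have -> : (fun t : Omega d => tnth t k) @^-1` A =
      [set t | forall i, B i (tnth t i)].
    apply/seteqP; split => [t At i|t /(_ k)]; last by rewrite /B eqxx.
    by rewrite /B; case: eqP => // ->.
  rewrite product_probE; last by move=> i; rewrite /B; case: ifP.
  rewrite (bigD1 k)//= /B eqxx big1 ?mule1// => i /negbTE ->.
  exact: probability_setT.
split=> [k|].
  have E n x : Q [set t | forall i, (i <= n)%N -> walk om k i t = x i] =
      (path_weight (om k) x n)%:E.
    rewrite -path_event_prob//; exact: QE.
  split=> [|n x].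
    have := E 0%N (fun=> 0); rewrite /path_weight eqxx big_ord0 mulr1 => <-.
    congr (Q _); apply/seteqP; split => [t h i|t]; last exact.
    by rewrite leqn0 => /eqP ->.
  by rewrite /= !E -EFinM /path_weight big_ord_recr /= mulrA.
move=> J A GA.
have /choice[B HB] : forall k, exists B : set R,
    measurable B /\ (k \in J -> A k = (fun t : Omega d => tnth t k) @^-1` B).
  move=> k; case: (boolP (k \in J)) => [kJ|_]; last by exists setT.
  suff [B mB <-] : preimage_set_system setT (fun t : Omega d => tnth t k)
    (@measurable _ (measurableTypeR R)) (A k) by exists B; rewrite setTI.
  apply: (smallest_sub _ _ (GA _ kJ)).
    exact: sigma_algebra_preimage (@sigma_algebra_measurable _ _).
  move=> C [n _ [D mD <-]].
  exists ((fun u => (state (om k) n u).1) @^-1` D) => //.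
  by rewrite -[X in measurable X]setTI; exact: (measurable_state _ _).1.
pose C k := if k \in J then B k else setT.
have -> : \bigcap_(i in [set` J]) A i =
    [set t : Omega d | forall i, C i (tnth t i)].
  apply/seteqP; split => [t h i|t h i /= iJ].
    by rewrite /C; case: ifP => // iJ; have := h i iJ; rewrite (HB i).2.
  by rewrite (HB i).2//; have := h i; rewrite /C iJ.
rewrite product_probE; last first.
  by move=> i; rewrite /C; case: ifP => // _; exact: (HB i).1.
rewrite (bigID (mem J))/= [X in (_ * X)%E]big1 ?mule1; last first.
  by move=> i /negbTE iJ; rewrite /C iJ; exact: probability_setT.
rewrite big_uniq ?fset_uniq//=; apply: eq_bigr => i iJ.
by rewrite /C iJ (HB i).2// QE//; exact: (HB i).1.
Qed.

End existence.
End rwre.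

(* Main.v *)
Require Import Defs.
From HB Require Import structures.
From mathcomp Require Import all_boot all_order all_algebra finmap zify ring lra.
From mathcomp Require Import all_classical all_reals all_analysis.
From mathcomp Require Import measurable_realfun.
Set Implicit Arguments.
Unset Strict Implicit.
Unset Printing Implicit Defensive.
Import Order.TTheory GRing.Theory Num.Theory.
Import numFieldNormedType.Exports.
Local Open Scope classical_set_scope.
Local Open Scope ring_scope.

(** The walk in an environment om is reversible for the weights
    exp (- V x) / om x, where V is the potential whose increments are
    ln (rho (om x)). If V climbs to a level L on both sides of the origin before
    it drops below - h, then on a time scale exp L the walk is trapped in this
    valley, and reversibility alone gives a lower bound for the return
    probability: by the Cauchy-Schwarz inequality,
    p_2n (0, 0) >= pi (0) P (still inside at time n)^2 / pi (valley)
    ([return_ge_survival]), while the probability of having left by time n is at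
    most n times the mass of the two ends of the valley, relative to pi (0)
    ([survival_ge]). So p_2n (0, 0) is at least a constant times
    exp (- h) / (width of the valley) for all n up to order exp L
    ([valley_return_ge]). With h = L / (4 d) and a width at most exp h, the
    product of d such probabilities is at least of order exp (- L / 2), and
    summing over n up to order exp L gives a partial sum of order exp (L / 2).
    Hence the series diverges as soon as, for arbitrarily large L, all d
    environments have such a valley ([sum_return_pinfty]).

    Such L exist almost surely. The potential on each side of the origin is a
    centred random walk with bounded steps, and it climbs to 2 L before dropping
    below - h / 2 with probability bounded below independently of L: this is the
    gambler's ruin estimate, which is quantitative in the number of steps
    allowed, so that a number of steps polynomial in L suffices
    ([climb_prob_ge_profile]). Along a sequence of scales that grows fast
    enough, the part of the environment seen at the earlier scales moves the
    potential by at most h / 2; only the increments over disjoint blocks of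
    sites then matter. Events that depend on disjoint blocks are independent
    ([prob_block_event]), so the second Borel-Cantelli lemma
    ([product_second_borel_cantelli]) yields infinitely many good scales.

    The second claim follows from the first by a last-exit decomposition. For
    the joint walk, whose trajectories have product weights by independence, the
    probability that the last visit to the origin takes place at time n is
    u_n q, where u_n is the probability of being at the origin at time n and q
    the probability of never returning. These events are disjoint and the u_n
    have an infinite sum, so q = 0 and there is almost surely no last visit
    ([recurrent_of_sum]). *)

(** * Return probabilities of reversible substochastic kernels *)

Section reversible_kernel.
Context (R : realFieldType) (I : finType) (K : I -> I -> R) (pi : I -> R).
Hypothesis K_ge0 : forall x y, 0 <= K x y.
Hypothesis K_le1 : forall x, \sum_y K x y <= 1.
Hypothesis pi_gt0 : forall x, 0 < pi x.
Hypothesis K_rev : forall x y, pi x * K x y = pi y * K y x.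

Definition kernel_op (f : I -> R) x := \sum_y K x y * f y.

Let delta o : I -> R := fun x => (x == o)%:R.
Let one : I -> R := fun=> 1.

Lemma kernel_op_sym f g :
  \sum_x pi x * kernel_op f x * g x = \sum_x pi x * f x * kernel_op g x.
Proof.
under eq_bigr do rewrite /kernel_op big_distrr big_distrl /=.
under [RHS]eq_bigr do rewrite /kernel_op big_distrr /=.
rewrite exchange_big /=; apply: eq_bigr => y _; apply: eq_bigr => x _.
by rewrite mulrA K_rev; ring.
Qed.

Lemma iter_kernel_op_sym n f g :
  \sum_x pi x * iter n kernel_op f x * g x =
  \sum_x pi x * f x * iter n kernel_op g x.
Proof.
elim: n f g => [//|n IH] f g.
by rewrite [in LHS]iterSr IH kernel_op_sym -iterS.
Qed.

Let sum_delta o f : \sum_x pi x * delta o x * f x = pi o * f o.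
Proof.
rewrite (bigD1 o)//= /delta eqxx mulr1 big1 ?addr0// => x /negbTE ->.
by rewrite mulr0 mul0r.
Qed.

Lemma iter_kernel_op_le1 n f : (forall x, f x <= 1) ->
  forall x, iter n kernel_op f x <= 1.
Proof.
move=> f1; elim: n => [//|n IH] x /=; apply: le_trans (K_le1 x).
by apply: ler_sum => y _; rewrite ler_piMr.
Qed.

Lemma iter_kernel_opB n f g x : iter n kernel_op (fun y => f y - g y) x =
  iter n kernel_op f x - iter n kernel_op g x.
Proof.
elim: n x => [//|n IH] x; rewrite /= /kernel_op -sumrB.
by apply: eq_bigr => y _; rewrite IH mulrBr.
Qed.

Lemma weighted_sum_sqr_le f :
  (\sum_x pi x * f x) ^+ 2 <= (\sum_x pi x) * \sum_x pi x * f x ^+ 2.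
Proof.
case: (pickP I) => [i0 _|I0]; last by rewrite !big_pred0// expr0n mul0r.
set S := \sum_x pi x; set m := \sum_x pi x * f x.
have S0 : 0 < S.
  rewrite /S (bigD1 i0)//= ltr_pwDl// sumr_ge0// => x _; exact: ltW.
have : 0 <= \sum_x pi x * (S * f x - m) ^+ 2.
  by apply: sumr_ge0 => x _; rewrite mulr_ge0 ?sqr_ge0// ltW.
have -> : \sum_x pi x * (S * f x - m) ^+ 2 =
    S * (S * (\sum_x pi x * f x ^+ 2) - m ^+ 2).
  rewrite (eq_bigr (fun x => S ^+ 2 * (pi x * f x ^+ 2)
     + ((- (2 * S * m)) * (pi x * f x) + m ^+ 2 * pi x))); last first.
    by move=> x _; ring.
  by rewrite !big_split/= -!big_distrr/= -/m -/S; ring.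
by rewrite pmulr_rge0// subr_ge0.
Qed.

(** Self-adjointness splits the 2 n steps in the middle:
    pi o * K^(2n) (o, o) is the squared norm of K^n delta_o, and Cauchy-Schwarz
    compares it with the scalar product of K^n delta_o and 1. *)
Lemma return_ge_survival o n :
  pi o * iter n kernel_op one o ^+ 2 <=
  (\sum_x pi x) * iter n.*2 kernel_op (delta o) o.
Proof.
rewrite -(ler_pM2l (pi_gt0 o)) mulrA -expr2 -exprMn.
rewrite -sum_delta -iter_kernel_op_sym [leRHS]mulrCA -sum_delta.
rewrite -addnn iterD -iter_kernel_op_sym.
rewrite (eq_bigr (fun x => pi x * iter n kernel_op (delta o) x)); last first.
  by move=> x _; rewrite /one mulr1.
apply: le_trans (weighted_sum_sqr_le _) _.
by under [X in _ * X <= _]eq_bigr do rewrite expr2 mulrA.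
Qed.

(** Up to the factor pi o, the mass lost at step j by the chain started at o is
    the scalar product of K^j delta_o, which is at most 1, with 1 - K 1. *)
Lemma survival_ge o n :
  pi o * (1 - iter n kernel_op one o) <=
  n%:R * \sum_x pi x * (1 - kernel_op one x).
Proof.
elim: n => [|n IH]; first by rewrite /= /one subrr mulr0 mul0r.
have h0 x : 0 <= 1 - kernel_op one x.
  by rewrite subr_ge0 (@iter_kernel_op_le1 1) // /one.
rewrite -[X in X <= _](subrKC (pi o * (1 - iter n kernel_op one o))).
rewrite -natr1 mulrDl mul1r lerD// -mulrBr.
have -> : 1 - iter n.+1 kernel_op one o - (1 - iter n kernel_op one o) =
    iter n kernel_op (fun x => one x - kernel_op one x) o.
  by rewrite iter_kernel_opB -iterSr; ring.
rewrite -sum_delta -iter_kernel_op_sym; apply: ler_sum => x _.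
rewrite -mulrA ler_pM2l// ler_piMl//.
by apply: iter_kernel_op_le1 => y; rewrite /delta; case: eqP.
Qed.

(** When the survival probability is at least 1/2, its square is at least 1/4,
    whence the factor 4. *)
Lemma return_ge o n :
  2 * n%:R * (\sum_x pi x * (1 - kernel_op one x)) <= pi o ->
  pi o <= 4 * (\sum_x pi x) * iter n.*2 kernel_op (delta o) o.
Proof.
move=> small; have := survival_ge o n; have := return_ge_survival o n.
set s := iter n _ one o; set t := iter _ _ _ o.
have po := pi_gt0 o => H1 H2.
have s2 : 2^-1 <= s.
  rewrite -(ler_pM2l po); have : 2 * (pi o * (1 - s)) <= pi o by lra.
  lra.
have : pi o * 4^-1 <= pi o * s ^+ 2.
  rewrite ler_pM2l// (_ : 4^-1 = 2^-1 ^+ 2); last by field.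
  by rewrite lerXn2r// nnegrE; lra.
lra.
Qed.

End reversible_kernel.

(** * Return probabilities in a valley of the potential *)

(** The target is 0 whatever the starting point x, so that the recursion on the
    first step closes. *)
Fixpoint return_prob (R : realType) (om : int -> R) n x : R :=
  if n is m.+1 then
    om x * return_prob om m (x + 1) + (1 - om x) * return_prob om m (x - 1)
  else (x == 0)%:R.

Section valley.
Context (R : realType) (om : int -> R).
Hypothesis om01 : forall x, 0 < om x < 1.

Lemma return_prob_ge0 n x : 0 <= return_prob om n x.
Proof.
elim: n x => [|n IH] x /=; first by case: eqP.
by have /andP[p q] := om01 x; rewrite addr_ge0 ?mulr_ge0// ?subr_ge0 ltW.
Qed.

Lemma jumpE x y : jump om x y =
  om x * (y == x + 1)%:R + (1 - om x) * (y == x - 1)%:R.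
Proof.
rewrite /jump; case: eqP => [->|_]; last by case: eqP => _ /=; ring.
by rewrite (_ : x + 1 == x - 1 = false) /=; [ring|apply/eqP; lia].
Qed.

Lemma sum_int_window (A N : nat) (F : int -> R) (x : int) :
  \sum_(j < N.+1) (j%:Z - A%:Z == x)%:R * F (j%:Z - A%:Z) =
  (0 <= x + A%:Z <= N%:Z)%R%:R * F x.
Proof.
case: (boolP (0 <= x + A%:Z <= N%:Z)) => [xN|xN]; last first.
  rewrite mul0r big1// => j _; rewrite (_ : _ == x = false) ?mul0r//.
  by apply/eqP => jx; move: xN (ltn_ord j); lia.
have lt : (absz (x + A%:Z)%R < N.+1)%N by lia.
rewrite (bigD1 (Ordinal lt))//= (_ : (absz _)%:Z - A%:Z = x); last by lia.
rewrite eqxx big1 ?addr0// => j jx; rewrite (_ : _ == x = false) ?mul0r//.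
by apply/eqP => E; move/eqP: jx; apply; apply: val_inj => /=; lia.
Qed.

Lemma sum_jump (A N : nat) (F : int -> R) (x : int) :
  \sum_(j < N.+1) jump om x (j%:Z - A%:Z) * F (j%:Z - A%:Z) =
  (0 <= x + 1 + A%:Z <= N%:Z)%R%:R * (om x * F (x + 1)) +
  (0 <= x - 1 + A%:Z <= N%:Z)%R%:R * ((1 - om x) * F (x - 1)).
Proof.
rewrite mulrCA -sum_int_window [X in _ + X]mulrCA -sum_int_window.
rewrite !big_distrr -big_split/=; apply: eq_bigr => j _.
by rewrite jumpE; ring.
Qed.

Variable V : int -> R.
Hypothesis V0 : V 0 = 0.
Hypothesis VS : forall x, V x - V (x - 1) = ln (rho (om x)).

Let conductance_rev x : expR (- V (x + 1)) / om (x + 1) * (1 - om (x + 1)) =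
  expR (- V x) / om x * om x.
Proof.
have [p0 p1] := andP (om01 (x + 1)); have [q0 _] := andP (om01 x).
have -> : - V x = - V (x + 1) + ln (rho (om (x + 1))).
  by rewrite -VS addrK; ring.
rewrite expRD lnK; last by rewrite posrE /rho divr_gt0// subr_gt0.
by rewrite /rho; field; rewrite !gt_eqF.
Qed.

Lemma jump_rev x y : expR (- V x) / om x * jump om x y =
  expR (- V y) / om y * jump om y x.
Proof.
rewrite /jump; case: eqP => [->|N1].
  rewrite (_ : x == _ = false); last by apply/eqP; lia.
  by rewrite addrK eqxx; exact: (esym (conductance_rev x)).
case: eqP => [->|N2].
  by rewrite subrK eqxx; have := conductance_rev (x - 1); rewrite subrK.
rewrite (_ : x == y + 1 = false); last by apply/eqP; lia.
  by rewrite (_ : x == y - 1 = false) ?mulr0//; apply/eqP; lia.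
Qed.

(** The kernel of the walk killed outside [-A, B] lies below that of the walk.
    It is reversible for exp (- V) / om, whose mass is at least 1 at the origin,
    at most (A + B + 1) exp h / eps in total, and at most exp (- L) / eps at each
    of the two ends, the only points where mass is lost. *)
Lemma valley_return_ge (eps h L : R) (A B n : nat) : 0 < eps ->
  (forall x, eps <= om x <= 1 - eps) ->
  (forall x, - A%:Z <= x <= B%:Z -> - h <= V x) ->
  L <= V (- A%:Z) -> L <= V B%:Z ->
  4 * n%:R <= eps * expR L ->
  eps <= 4 * (A + B).+1%:R * expR h * return_prob om n.*2 0.
Proof.
move=> eps0 ell Vh VA VB nL.
pose N := (A + B)%N; pose e (i : 'I_N.+1) := i%:Z - A%:Z.
pose K i j := jump om (e i) (e j); pose pi i := expR (- V (e i)) / om (e i).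
have omp x : 0 < om x by case/andP: (om01 x).
have omq x : 0 < 1 - om x by rewrite subr_gt0; case/andP: (om01 x).
have K0 i j : 0 <= K i j.
  by rewrite /K jumpE addr_ge0// mulr_ge0// ltW.
have K1E i : kernel_op K (fun=> 1) i =
    (0 <= e i + 1 + A%:Z <= N%:Z)%R%:R * (om (e i) * 1) +
    (0 <= e i - 1 + A%:Z <= N%:Z)%R%:R * ((1 - om (e i)) * 1).
  exact: (@sum_jump A N (fun=> 1)).
have K1 i : \sum_j K i j <= 1.
  have := K1E i; rewrite /kernel_op; under eq_bigr do rewrite mulr1.
  move=> ->; have := omp (e i); have := omq (e i).
  by case: (_ <= _ <= _); case: (_ <= _ <= _) => /=; lra.
have pi0 i : 0 < pi i by rewrite divr_gt0// expR_gt0.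
have Krev i j : pi i * K i j = pi j * K j i by exact: jump_rev.
have Aord : (A < N.+1)%N by rewrite ltnS leq_addr.
pose o := Ordinal Aord.
have eo : e o = 0 by rewrite /e subrr.
have pio : 1 <= pi o.
  rewrite /pi eo V0 oppr0 expR0 mul1r invf_ge1//; case/andP: (om01 0) => _.
  exact: ltW.
have pimax i : pi i <= expR h / eps.
  rewrite /pi ler_pM ?expR_ge0 ?invr_ge0 ?(ltW (omp _))//.
    rewrite ler_expR lerNl Vh//; have := ltn_ord i; rewrite /e /N; lia.
  by rewrite lef_pV2 ?posrE//; case/andP: (ell (e i)).
have pisum : \sum_i pi i <= N.+1%:R * (expR h / eps).
  rewrite -[X in X%:R * _]card_ord mulr_natl -sumr_const.
  by apply: ler_sum.
have leave : \sum_i pi i * (1 - kernel_op K (fun=> 1) i) <=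
    2 * (expR (- L) / eps).
  have piend i : (i == ord0) || (i == ord_max) -> pi i <= expR (- L) / eps.
    move=> iend; rewrite /pi ler_pM ?expR_ge0 ?invr_ge0 ?(ltW (omp _))//.
      rewrite ler_expR lerN2; case/orP: iend => /eqP ->; rewrite /e /=.
        by rewrite sub0r.
      by rewrite /N PoszD addrC addKr.
    by rewrite lef_pV2 ?posrE//; case/andP: (ell (e i)).
  apply: (@le_trans _ _ (\sum_i ((i == ord0)%:R * pi i + (i == ord_max)%:R * pi i))).
    apply: ler_sum => i _; rewrite K1E -mulrDl mulrC ler_pM2r//.
    have := omp (e i); have := omq (e i).
    have -> : (0 <= e i + 1 + A%:Z <= N%:Z) = (i != ord_max).
      rewrite -val_eqE/= /e /N; have := ltn_ord i; rewrite /N => iN; apply/idP/idP; lia.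
    have -> : (0 <= e i - 1 + A%:Z <= N%:Z) = (i != ord0).
      rewrite -val_eqE/= /e /N; have := ltn_ord i; rewrite /N => iN; apply/idP/idP; lia.
    by case: eqP => _; case: eqP => _ /=; lra.
  have pick j : \sum_i (i == j)%:R * pi i = pi j.
    rewrite (bigD1 j) //= eqxx mul1r big1 ?addr0// => i /negbTE ->.
    by rewrite mul0r.
  rewrite big_split/= !pick [2 * _]mulr_natl mulr2n.
  by apply: lerD; apply: piend; rewrite eqxx ?orbT.
have small : 2 * n%:R * (\sum_i pi i * (1 - kernel_op K (fun=> 1) i)) <= pi o.
  apply: le_trans pio; apply: (@le_trans _ _ (2 * n%:R * (2 * (expR (- L) / eps)))).
    by rewrite ler_wpM2l// mulr_ge0.
  rewrite expRN [leLHS](_ : _ = 4 * n%:R / (eps * expR L)); last first.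
    by field; rewrite !gt_eqF// expR_gt0.
  by rewrite ler_pdivrMr ?mul1r// mulr_gt0// expR_gt0.
have := return_ge K0 K1 pi0 Krev small.
set t := iter _ _ _ _ => H.
have tle : 0 <= t <= return_prob om n.*2 0.
  rewrite /t -eo; move: n.*2; suff tle m i :
    0 <= iter m (kernel_op K) (fun x => (x == o)%:R) i <= return_prob om m (e i).
    by move=> m; exact: tle.
  elim: m i => [|m IH] i /=.
    rewrite /e (_ : (i%:Z - A%:Z == 0) = (i == o)) ?lexx ?ler0n//.
    by rewrite subr_eq0 eqz_nat.
  apply/andP; split.
    by apply: sumr_ge0 => j _; rewrite mulr_ge0//; case/andP: (IH j).
  apply: (@le_trans _ _ (\sum_j K i j * return_prob om m (e j))).
    by apply: ler_sum => j _; rewrite ler_wpM2l//; case/andP: (IH j).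
  rewrite (sum_jump A N (return_prob om m)) lerD//.
    apply: ler_piMl; last by rewrite lern1 leq_b1.
    by rewrite mulr_ge0 ?return_prob_ge0// ltW.
  apply: ler_piMl; last by rewrite lern1 leq_b1.
  by rewrite mulr_ge0 ?return_prob_ge0// ltW.
case/andP: tle => t0 tle.
have H2 : 1 <= 4 * (N.+1%:R * (expR h / eps)) * return_prob om n.*2 0.
  apply: le_trans pio (le_trans H _); rewrite ler_pM ?mulr_ge0//.
    by apply: sumr_ge0 => i _; exact: ltW.
  by rewrite ler_pM2l.
rewrite -[leLHS]mulr1; apply: le_trans (ler_wpM2l (ltW eps0) H2) _.
rewrite [leLHS](_ : _ = 4 * N.+1%:R * expR h * return_prob om n.*2 0 * (eps / eps));
  last by ring.
by rewrite divff ?mulr1 ?gt_eqF.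
Qed.

End valley.

(** * Markov chains given by the weights of their trajectories *)

(** The states have finitely many neighbours, listed by [nb], so that the law of
    the future given a trajectory is obtained from finite sums over the next
    state only. *)
Section chain.
Context d (T : measurableType d) (R : realType) (Q : probability T R).
Context (S : eqType) (Z : nat -> T -> S) (nb : S -> seq S) (J : S -> S -> R).

Definition path_event (n : nat) (x : nat -> S) :=
  [set t | forall i, (i <= n)%N -> Z i t = x i].

Definition extend_path n (x : nat -> S) y i := if (i <= n)%N then x i else y.

Hypothesis mZ : forall n s, measurable [set t | Z n t = s].
Hypothesis path_step : forall n x,
  Q (path_event n.+1 x) = (Q (path_event n x) * (J (x n) (x n.+1))%:E)%E.
Hypothesis nb_uniq : forall s, uniq (nb s).
Hypothesis J_sum1 : forall s, \sum_(y <- nb s) J s y = 1.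

Lemma measurable_path_event n x : measurable (path_event n x).
Proof.
rewrite (_ : path_event n x = \bigcap_(i in [set i | (i <= n)%N])
    [set t | Z i t = x i]).
  by apply: bigcap_measurableType => i _; exact: mZ.
by apply/seteqP; split => t h i; exact: h.
Qed.

Let QE (A : set T) : measurable A -> Q A = (fine (Q A))%:E.
Proof. by move=> mA; rewrite fineK// fin_num_measure. Qed.

Lemma path_event_extend n x y : path_event n.+1 (extend_path n x y) =
  path_event n x `&` [set t | Z n.+1 t = y].
Proof.
apply/seteqP; split => [t h|t [h1 h2] i].
  split => [i iN|]; first by rewrite h ?leqW// /extend_path iN.
  by rewrite /mkset h// /extend_path ltnn.
rewrite leq_eqVlt /extend_path => /orP[/eqP ->|]; first by rewrite ltnn.
by rewrite ltnS => iN; rewrite iN h1.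
Qed.

Let extend_path_n n x y : extend_path n x y n = x n.
Proof. by rewrite /extend_path leqnn. Qed.

Let extend_path_n1 n x y : extend_path n x y n.+1 = y.
Proof. by rewrite /extend_path ltnn. Qed.

Let path_event_extend_step n x y :
  Q (path_event n.+1 (extend_path n x y)) =
  (Q (path_event n x) * (J (x n) y)%:E)%E.
Proof.
rewrite path_step extend_path_n extend_path_n1.
rewrite (_ : path_event n _ = path_event n x)//.
by apply/seteqP; split => t h i iN; have := h i iN; rewrite /extend_path iN.
Qed.

Let prob_mem_seq (A : set T) n (s : seq S) : measurable A -> uniq s ->
  measurable (A `&` [set t | Z n t \in s]) /\
  Q (A `&` [set t | Z n t \in s]) =
  (\sum_(y <- s) Q (A `&` [set t | Z n t = y]))%E.
Proof.
move=> mA; elim: s => [_|y s IH /= /andP[ys us]].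
  rewrite big_nil (_ : _ `&` _ = set0) ?measure0//.
  by apply/seteqP; split => // t [].
have [m1 E1] := IH us.
have E2 : A `&` [set t | Z n t \in y :: s] =
    (A `&` [set t | Z n t = y]) `|` (A `&` [set t | Z n t \in s]).
  rewrite -setIUr; congr (_ `&` _); apply/seteqP; split => t /=.
    by rewrite inE => /orP[/eqP|]; [left|right].
  by rewrite inE => -[->|->]; rewrite ?eqxx ?orbT.
have m2 : measurable (A `&` [set t | Z n t = y]) by exact: measurableI.
split; first by rewrite E2; exact: measurableU.
rewrite E2 big_cons -E1; apply: measureU => //.
by apply/seteqP; split => // t [[_ /= ->] [_ /=]]; rewrite (negbTE ys).
Qed.

(** The next state is almost surely a neighbour of the current one, because the
    weights of the neighbours add up to 1. Every computation below is an
    induction that uses this decomposition. *)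
Lemma path_event_split n x (E : set T) : measurable E ->
  Q (path_event n x `&` E) = (\sum_(y <- nb (x n))
    Q (path_event n.+1 (extend_path n x y) `&` E))%E.
Proof.
move=> mE; set C := path_event n x; set U := [set t | Z n.+1 t \in nb (x n)].
have mC : measurable C by exact: measurable_path_event.
have [mCU CU] := prob_mem_seq n.+1 mC (nb_uniq (x n)).
have [mCEU CEU] := prob_mem_seq n.+1 (measurableI _ _ mC mE) (nb_uniq (x n)).
have QCU : Q (C `&` U) = Q C.
  rewrite CU (eq_bigr (fun y => (fine (Q C) * J (x n) y)%:E)) => [|y _].
    by rewrite sumEFin -big_distrr/= J_sum1 mulr1 -QE.
  by rewrite -path_event_extend path_event_extend_step QE.
have mU : measurable U.
  have [+ _] := prob_mem_seq n.+1 (@measurableT _ T) (nb_uniq (x n)).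
  by rewrite setTI.
have Q0 : Q (C `\` U) = 0%E.
  have mD : measurable (C `\` U) by exact: measurableD.
  have : Q C = (Q (C `\` U) + Q (C `&` U))%E := measureDI Q mC mU.
  rewrite QCU (QE mC) (QE mD) -EFinD => -[].
  by move=> h; congr (_%:E); lra.
have -> : Q (C `&` E) = (Q ((C `&` E) `\` U) + Q (C `&` E `&` U))%E.
  by apply: measureDI => //; exact: measurableI.
rewrite [X in (X + _)%E](_ : _ = 0%E).
  rewrite add0e CEU; apply: eq_bigr => y _; rewrite path_event_extend.
  by rewrite setIAC.
apply/eqP; rewrite -measure_le0 -Q0; apply: le_measure; rewrite ?inE.
- by apply: measurableD => //; exact: measurableI.
- exact: measurableD.
- by apply: setSD; exact: subIsetl.
Qed.

Fixpoint avoid_prob o m s : R :=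
  if m is m'.+1 then
    \sum_(y <- nb s) J s y * ((y != o)%:R * avoid_prob o m' y)
  else 1.

Fixpoint hit_prob o m s : R :=
  if m is m'.+1 then \sum_(y <- nb s) J s y * hit_prob o m' y
  else (s == o)%:R.

Definition avoid_event o n m :=
  [set t | forall i, (n < i <= n + m)%N -> Z i t != o].

Lemma measurable_avoid_event o n m : measurable (avoid_event o n m).
Proof.
rewrite (_ : avoid_event o n m = \bigcap_(i in [set i | (n < i <= n + m)%N])
    ~` [set t | Z i t = o]).
  by apply: bigcap_measurableType => i _; apply: measurableC; exact: mZ.
by apply/seteqP; split => t h i /h /eqP.
Qed.

Let sum_step n x (F : S -> R) :
  (\sum_(y <- nb (x n)) (Q (path_event n x) * (J (x n) y * F y)%:E) =
  Q (path_event n x) * (\sum_(y <- nb (x n)) J (x n) y * F y)%:E)%E.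
Proof.
rewrite QE; last exact: measurable_path_event.
by under eq_bigr do rewrite -EFinM; rewrite sumEFin -big_distrr/= EFinM.
Qed.

Lemma path_avoid_prob o m n x : Q (path_event n x `&` avoid_event o n m) =
  (Q (path_event n x) * (avoid_prob o m (x n))%:E)%E.
Proof.
elim: m n x => [|m IH] n x.
  rewrite mule1; congr (Q _); apply/seteqP; split => [t []//|t h].
  by split => // i; rewrite addn0; case: ltngtP.
rewrite path_event_split; last exact: measurable_avoid_event.
rewrite /= -sum_step; apply: eq_bigr => y _.
have [->|yo] := eqVneq y o.
  rewrite mul0r mulr0 mule0 path_event_extend (_ : _ `&` _ = set0) ?measure0//.
  apply/seteqP; split => // t [[_ /= zy]] /(_ n.+1).
  by rewrite zy eqxx addnS ltnSn ltnS leq_addr => /(_ isT).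
rewrite mul1r EFinM muleA -path_event_extend_step.
have -> : path_event n.+1 (extend_path n x y) `&` avoid_event o n m.+1 =
    path_event n.+1 (extend_path n x y) `&` avoid_event o n.+1 m.
  apply/seteqP; split => t [h1 h2]; split => // i.
    by move=> /andP[ni im]; apply: h2; rewrite (ltn_trans _ ni)//= addnS.
  rewrite leq_eqVlt => /andP[/orP[/eqP <- _|ni im]].
    by rewrite h1// /extend_path ltnn.
  by apply: h2; rewrite ni addSnnS.
by rewrite IH extend_path_n1.
Qed.

Lemma path_hit_prob o m n x :
  Q (path_event n x `&` [set t | Z (n + m) t = o]) =
  (Q (path_event n x) * (hit_prob o m (x n))%:E)%E.
Proof.
elim: m n x => [|m IH] n x.
  rewrite addn0 /=; case: eqP => [xo|xo].
    rewrite mule1; congr (Q _); apply/seteqP; split => [t []//|t h].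
    by split => //=; rewrite h.
  rewrite mule0 (_ : _ `&` _ = set0) ?measure0//.
  by apply/seteqP; split => // t [/(_ n (leqnn n)) zx /= zo]; rewrite -zx in xo.
rewrite path_event_split; last exact: mZ.
rewrite /= -sum_step; apply: eq_bigr => y _.
rewrite EFinM muleA -path_event_extend_step -addSnnS IH.
by rewrite extend_path_n1.
Qed.

(** The Markov property at the deterministic time n + k, where the state is o.
    The induction on k refines the known trajectory up to that time. *)
Lemma path_visit_avoid o m k n x :
  Q (path_event n x `&` ([set t | Z (n + k) t = o] `&` avoid_event o (n + k) m)) =
  (Q (path_event n x `&` [set t | Z (n + k) t = o]) * (avoid_prob o m o)%:E)%E.
Proof.
have mA i : measurable (avoid_event o i m) by exact: measurable_avoid_event.
elim: k n x => [|k IH] n x.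
  rewrite addn0; have [xo|xo] := eqVneq (x n) o.
    rewrite setIA (_ : path_event n x `&` [set t | Z n t = o] = path_event n x).
      by rewrite path_avoid_prob xo.
    apply/seteqP; split => [t []//|t h]; split => //=.
    by rewrite h.
  rewrite setIA (_ : path_event n x `&` [set t | Z n t = o] = set0).
    by rewrite set0I !measure0 mul0e.
  apply/seteqP; split => // t [/(_ n (leqnn n)) zx /= zo].
  by rewrite -zx zo eqxx in xo.
rewrite path_event_split; last by apply: measurableI.
rewrite [in RHS]path_event_split// -addSnnS ge0_sume_distrl//.
by apply: eq_bigr => y _; exact: IH.
Qed.

Context (o : S).
Hypothesis Z0 : Q [set t | Z 0%N t = o] = 1%E.

Let path_event0 A : measurable A -> Q (path_event 0 (fun=> o) `&` A) = Q A.
Proof.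
move=> mA; have -> : path_event 0 (fun=> o) = [set t | Z 0%N t = o].
  apply/seteqP; split => [t h|t h i]; first exact: h.
  by rewrite leqn0 => /eqP ->.
have mZo := mZ 0 o.
rewrite (_ : Q A = Q (A `\` [set t | Z 0%N t = o]) + Q (A `&` [set t | Z 0%N t = o]))%E;
  last exact: measureDI.
rewrite setIC [X in _ = (X + _)%E](_ : _ = 0%E) ?add0e//.
apply/eqP; rewrite -measure_le0.
apply: (@le_trans _ _ (Q (~` [set t | Z 0%N t = o]))).
  apply: le_measure => [||t []//]; rewrite inE; first exact: measurableD.
  exact: measurableC.
by rewrite probability_setC// Z0 subee.
Qed.

Lemma chain_hit_prob z n : Q [set t | Z n t = z] = (hit_prob z n o)%:E.
Proof.
rewrite -path_event0//; have := path_hit_prob z n 0 (fun=> o); rewrite add0n => ->.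
rewrite (_ : path_event 0 (fun=> o) = [set t | Z 0%N t = o]) ?Z0 ?mul1e//.
apply/seteqP; split => [t h|t h i]; first exact: h.
by rewrite leqn0 => /eqP ->.
Qed.

Definition last_visit n :=
  [set t | Z n t = o] `&` [set t | forall i, (n < i)%N -> Z i t != o].

Let last_visitE n : last_visit n =
  \bigcap_m ([set t | Z n t = o] `&` avoid_event o n m).
Proof.
apply/seteqP; split => [t [zo h] m _|t h].
  by split => // i /andP[ni _]; exact: h.
split; first by case: (h 0%N I).
move=> i ni; case: (h i I) => _; apply; rewrite ni; exact: leq_addl.
Qed.

Let measurable_visit_avoid n m :
  measurable ([set t | Z n t = o] `&` avoid_event o n m).
Proof. by apply: measurableI => //; exact: measurable_avoid_event. Qed.

Lemma measurable_last_visit n : measurable (last_visit n).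
Proof.
by rewrite last_visitE; apply: bigcap_measurableType => m _.
Qed.

(** Both sides are limits of the Markov identity over finite horizons; at time 0
    the chain sits at o, so that the probability of avoiding o forever after is
    that of [last_visit 0]. *)
Lemma last_visit_prob n :
  Q (last_visit n) = (Q [set t | Z n t = o] * Q (last_visit 0))%E.
Proof.
have cvg k : (Q [set t | Z k t = o] * (avoid_prob o m o)%:E)%E @[m --> \oo] -->
    Q (last_visit k).
  rewrite last_visitE (_ : (fun m => _) =
    Q \o (fun m => [set t | Z k t = o] `&` avoid_event o k m)).
    apply: nonincreasing_cvg_mu => //.
    - by rewrite ltey_eq fin_num_measure.
    - by apply: bigcap_measurableType.
    - move=> m m' mm'; apply/subsetPset => t [zo h]; split => // i /andP[ki im].
      by apply: h; rewrite ki (leq_trans im)// leq_add2l.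
  apply/funext => m /=; rewrite -(path_event0 (mZ k o)) -[RHS]path_event0//.
  exact: esym (path_visit_avoid o m k 0 (fun=> o)).
have := cvg 0%N; rewrite Z0; under eq_fun do rewrite mul1e.
move=> h; apply: (cvg_unique _ (cvg n)) => //.
rewrite QE//; apply: cvgeZl => //.
Qed.

(** The last visit takes place at one time at most, so the probabilities
    u_n * q of [last_visit_prob] have a sum at most 1; as the u_n have an
    infinite sum, q = 0. *)
Lemma recurrent_of_sum :
  (\sum_(1 <= n <oo) Q [set t | Z n.*2 t = o] = +oo)%E ->
  {ae Q, forall t, infinite_set [set n | Z n t = o]}.
Proof.
move=> sumoo.
have disj i j : (i < j)%N -> last_visit i `&` last_visit j = set0.
  move=> ij; apply/seteqP; split => // t [[_ /= /(_ j ij) zj] [/= zo _]].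
  by rewrite zo eqxx in zj.
have triv : trivIset setT (fun n => last_visit n.*2).
  apply/trivIsetP => i j _ _; case: (ltngtP i j) => // ij _.
    by apply: disj; rewrite ltn_double.
  by rewrite setIC; apply: disj; rewrite ltn_double.
have q0 : Q (last_visit 0) = 0%E.
  have mlast n : measurable (last_visit n) := measurable_last_visit n.
  have : (\sum_(0 <= n <oo) Q (last_visit n.*2) <= 1)%E.
    rewrite (_ : (\sum_(0 <= n <oo) Q (last_visit n.*2))%E =
      Q (\bigcup_(n in [set: nat]) last_visit n.*2)).
      by apply: probability_le1; apply: bigcupT_measurable => n; exact: mlast.
    rewrite measure_bigcup//.
    by apply: eq_eseriesl => n; rewrite in_setT.
  under eq_eseriesr do rewrite last_visit_prob muleC.
  rewrite (QE (mlast 0%N)) nneseriesZl// -(QE (mlast 0%N)) => H.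
  apply/eqP; rewrite eq_le measure_ge0 andbT.
  rewrite leNgt; apply/negP => qpos; move: H.
  have -> : (\sum_(0 <= n <oo) Q [set t | Z n.*2 t = o] = +oo)%E.
    apply/eqP; rewrite -leye_eq -sumoo.
    by rewrite (nneseries_split 0 1)//= add0n leeDr// sume_ge0.
  by rewrite gt0_muley.
have lastN n : Q.-negligible (last_visit n).
  apply/(negligibleP Q); first exact: measurable_last_visit.
  by apply: eq_trans (last_visit_prob n) _; rewrite q0 mule0.
have Z0N : Q.-negligible (~` [set t | Z 0%N t = o]).
  apply/(negligibleP Q); first exact: measurableC.
  by apply: eq_trans (probability_setC _ _) _; rewrite ?Z0 ?subee.
apply: negligibleS (negligibleU Z0N (negligible_bigcup lastN)) => t /=.
move=> /contrapT /finite_seqP[s Es].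
have [z0|z0] := pselect (Z 0%N t = o); last by left.
right.
have ex0 : exists n, Z n t == o by exists 0%N; apply/eqP.
have bound n : Z n t == o -> (n <= \max_(i <- s) i)%N.
  move=> /eqP zn; have : [set` s] n by rewrite -Es.
  by move=> /= ns; apply: leq_bigmax_seq.
have [n /eqP zn nmax] := ex_maxnP ex0 bound.
exists n => //; split => // i ni; apply/negP => /nmax; lia.
Qed.
End chain.

(** * One walk, and several independent walks, as Markov chains *)

Section rwre_chain.
Context (R : realType).

Definition int_nb (x : int) : seq int := [:: x + 1; x - 1].

Lemma int_nb_uniq x : uniq (int_nb x).
Proof. by rewrite /= inE andbT; apply/eqP; lia. Qed.

Lemma jump_sum1 (om : int -> R) x : \sum_(y <- int_nb x) jump om x y = 1.
Proof.
rewrite /int_nb !big_cons big_nil !jumpE !eqxx.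
rewrite (_ : x + 1 == x - 1 = false); last by apply/eqP; lia.
rewrite (_ : x - 1 == x + 1 = false) /=; last by apply/eqP; lia.
by ring.
Qed.

Lemma measurable_state d (T : measurableType d) (Q : probability T R)
  (X : {RV Q >-> int}) (A : set int) : measurable [set t | A (X t)].
Proof. by rewrite -[X in measurable X]setTI; exact: measurable_funP. Qed.

Lemma rwre_return_prob d (T : measurableType d) (Q : probability T R)
    (om : int -> R) (X : nat -> {RV Q >-> int}) : is_rwre om X ->
  forall n, Q [set t | X n t = 0] = (return_prob om n 0)%:E.
Proof.
move=> [X0 XS] n.
rewrite (@chain_hit_prob _ _ _ Q _ X int_nb (jump om) _ _ _ _ 0)//.
- congr (_%:E); suff hitE m x :
    hit_prob int_nb (jump om) 0 m x = return_prob om m x by exact: hitE.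
  elim: m x => [//|m IH] x /=.
  rewrite /int_nb !big_cons big_nil addr0 !IH !jumpE !eqxx.
  rewrite (_ : x + 1 == x - 1 = false); last by apply/eqP; lia.
  rewrite (_ : x - 1 == x + 1 = false) /=; last by apply/eqP; lia.
  by ring.
- by move=> k s; exact: (measurable_state (X k) [set s]).
- exact: int_nb_uniq.
- exact: jump_sum1.
Qed.

Section joint.
Context d (T : measurableType d) (Q : probability T R) (D : nat)
  (om : 'I_D -> int -> R) (X : 'I_D -> nat -> {RV Q >-> int}).
Hypothesis rwreX : forall k, is_rwre (om k) (X k).
Hypothesis indX : independent_processes X.

(** The walks are put together in a single chain on {ffun 'I_D -> int}: its
    moves are the choices of a direction for each walk. *)
Definition joint_walk n t : {ffun 'I_D -> int} := [ffun k => X k n t].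

Definition joint_move (s : {ffun 'I_D -> int}) (b : {ffun 'I_D -> bool}) :
  {ffun 'I_D -> int} := [ffun k => if b k then s k + 1 else s k - 1].

Definition joint_nb s := [seq joint_move s b | b <- enum {: {ffun 'I_D -> bool}}].

Definition joint_jump (s s' : {ffun 'I_D -> int}) :=
  \prod_k jump (om k) (s k) (s' k).

Lemma joint_nb_uniq s : uniq (joint_nb s).
Proof.
rewrite map_inj_uniq ?enum_uniq// => b b' /ffunP bb'; apply/ffunP => k.
by have := bb' k; rewrite !ffunE; case: (b k); case: (b' k) => //; lia.
Qed.

Lemma joint_jump_sum1 s : \sum_(s' <- joint_nb s) joint_jump s s' = 1.
Proof.
rewrite big_map big_enum /=.
pose F k (b : bool) := jump (om k) (s k) (if b then s k + 1 else s k - 1).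
rewrite (eq_bigr (fun b : {ffun _ -> _} => \prod_k F k (b k))); last first.
  by move=> b _; apply: eq_bigr => k _; rewrite ffunE.
rewrite -bigA_distr_bigA/= big1// => k _; rewrite big_bool /F /=.
by have := jump_sum1 (om k) (s k); rewrite /int_nb !big_cons big_nil addr0.
Qed.

Lemma independent_rect (A : 'I_D -> set T) :
  (forall k, <<s \bigcup_n g_sigma_algebra_preimage (X k n) >> (A k)) ->
  Q [set t | forall k, A k t] = (\prod_k Q (A k))%E.
Proof.
move=> hA; have := @indX [fset k in 'I_D]%fset A (fun k _ => hA k).
have -> : \bigcap_(k in [set` [fset k in 'I_D]%fset]) A k = [set t | forall k, A k t].
  by apply/seteqP; split => t h k => [|_]; apply: h => //=; rewrite !inE.
move=> ->; rewrite big_uniq ?fset_uniq//=; apply: eq_bigl => k.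
by rewrite !inE.
Qed.

Lemma sigma_state k n (B : set int) :
  <<s \bigcup_n g_sigma_algebra_preimage (X k n) >> [set t | B (X k n t)].
Proof.
by apply: sub_sigma_algebra; exists n => //; exists B => //; rewrite setTI.
Qed.

Lemma joint_path_event n x : path_event joint_walk n x =
  [set t | forall k, [set t | forall i, (i <= n)%N -> X k i t = x i k] t].
Proof.
apply/seteqP; split => [t h k i iN|t h i iN].
  by rewrite -h// ffunE.
by apply/ffunP => k; rewrite ffunE; exact: (h k i iN).
Qed.

Lemma joint_path_prob n x : Q (path_event joint_walk n x) =
  (\prod_k Q [set t | forall i, (i <= n)%N -> X k i t = x i k])%E.
Proof.
rewrite joint_path_event independent_rect// => k.
rewrite (_ : [set t | _] = \bigcap_(i in [set i | (i <= n)%N])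
    [set t | [set x i k] (X k i t)]); last first.
  by apply/seteqP; split => t h i; exact: h.
apply: (@bigcap_measurableType _ (g_sigma_algebraType
  (\bigcup_n g_sigma_algebra_preimage (X k n)))) => i _.
exact: sigma_state.
Qed.

Lemma joint_path_step n x : Q (path_event joint_walk n.+1 x) =
  (Q (path_event joint_walk n x) * (joint_jump (x n) (x n.+1))%:E)%E.
Proof.
rewrite !joint_path_prob -prodEFin -big_split/=; apply: eq_bigr => k _.
by have [_ /(_ n (fun i => x i k))] := rwreX k.
Qed.

Lemma joint_walk_eq n s : [set t | joint_walk n t = s] =
  [set t | forall k, [set t | [set s k] (X k n t)] t].
Proof.
apply/seteqP; split => [t /= <- k|t h]; first by rewrite /= ffunE.
by apply/ffunP => k; rewrite ffunE; exact: (h k).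
Qed.

Lemma joint_walk_prob n s : Q [set t | joint_walk n t = s] =
  (\prod_k Q [set t | X k n t = s k])%E.
Proof.
by rewrite joint_walk_eq independent_rect// => k; exact: sigma_state.
Qed.

(** Independence makes [joint_walk] a chain whose weights are products, and its
    return probability the product of those of the walks. *)
Lemma joint_recurrent :
  (\sum_(1 <= n <oo) \prod_k Q [set t | X k n.*2 t = 0%R] = +oo)%E ->
  {ae Q, forall t, infinite_set [set n | forall k, X k n t = 0]}.
Proof.
move=> sumoo; pose o : {ffun 'I_D -> int} := [ffun=> 0].
have E t n : (joint_walk n t = o) = (forall k, X k n t = 0).
  apply/propext; split => [/ffunP h k|h]; first by have := h k; rewrite !ffunE.
  by apply/ffunP => k; rewrite !ffunE.
have mZ n s : measurable [set t | joint_walk n t = s].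
  rewrite joint_walk_eq (_ : [set t | _] = \bigcap_(k : 'I_D) [set t | [set s k] (X k n t)]).
    apply: fin_bigcap_measurable => // k _.
    exact: (measurable_state (X k n) [set s k]).
  by apply/seteqP; split => t h k; [move=> _|]; exact: h.
have Z0 : Q [set t | joint_walk 0 t = o] = 1%E.
  rewrite joint_walk_prob big1// => k _; rewrite ffunE.
  by have [] := rwreX k.
have := recurrent_of_sum mZ joint_path_step joint_nb_uniq joint_jump_sum1 Z0.
under eq_eseriesr do rewrite joint_walk_prob.
under eq_eseriesr do under eq_bigr do rewrite ffunE.
move=> /(_ sumoo); apply: filterS => t; under eq_set do rewrite E.
by [].
Qed.

End joint.
End rwre_chain.

(** * Gambler's ruin with a bounded number of steps *)

Lemma integrable_bounded d (T : measurableType d) (R : realType)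
    (nu : probability T R) (f : T -> R) (B : R) :
  measurable_fun setT f -> (forall x, `|f x| <= B) ->
  nu.-integrable setT (EFin \o f).
Proof.
move=> mf fB; apply: measurable_bounded_integrable => //.
  by rewrite ltey_eq fin_num_measure.
exists B; split; first exact: num_real.
by move=> y By x _; apply: le_trans (fB x) (ltW By).
Qed.

Section gambler.
Context (R : realType) dE (E : measurableType dE) (nu : probability E R).
Context (g : E -> R) (C s2 : R).
Implicit Types a b M s : R.
Hypothesis mg : measurable_fun setT g.
Hypothesis gC : forall x, `|g x| <= C.
Hypothesis g_mean : (\int[nu]_x g x)%R = 0.
Hypothesis g_var : (\int[nu]_x (g x ^+ 2))%R = s2.

Fixpoint climbs a b s (t : seq E) :=
  (- a <= s) &&
  ((b <= s) || (if t is x :: t' then climbs a b (s + g x) t' else false)).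

Lemma measurable_climbs (a b : R) n :
  measurable [set p : R * n.-tuple E | climbs a b p.1 p.2].
Proof.
have m1 c k : measurable [set p : R * k.-tuple E | c <= p.1].
  rewrite (_ : [set p | _] = fst @^-1` [set` `[c, +oo[]); last first.
    by apply/seteqP; split => p /=; rewrite in_itv/= andbT.
  have mf : measurable_fun setT (@fst R (k.-tuple E)) by exact: measurable_fst.
  by rewrite -[X in measurable X]setTI; apply: mf => //; exact: measurable_itv.
elim: n => [|n IH].
  rewrite (_ : [set p | _] = [set p : R * 0.-tuple E | - a <= p.1] `&`
    [set p : R * 0.-tuple E | b <= p.1]); first exact: measurableI.
  by apply/seteqP; split => -[s t] /=; rewrite (tuple0 t)/= orbF => /andP.
pose next (p : R * n.+1.-tuple E) := (p.1 + g (tnth p.2 ord0), [tuple of behead p.2]).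
have mnext : measurable_fun setT next.
  have ms : measurable_fun setT (@snd R (n.+1.-tuple E)) by exact: measurable_snd.
  apply: measurable_fun_pair.
    apply: measurable_funD; first exact: measurable_fst.
    have mt : measurable_fun setT (fun p : R * n.+1.-tuple E => tnth p.2 ord0).
      by apply: (@measurableT_comp _ _ _ _ _ _ (fun t : n.+1.-tuple E => tnth t ord0));
        [exact: measurable_tnth|exact: ms].
    exact: measurableT_comp mg mt.
  by apply: (@measurableT_comp _ _ _ _ _ _ (fun t : n.+1.-tuple E => [tuple of behead t]));
    [exact: measurable_behead|exact: ms].
rewrite (_ : [set p | _] = [set p : R * n.+1.-tuple E | - a <= p.1] `&`
    ([set p : R * n.+1.-tuple E | b <= p.1] `|`
     next @^-1` [set p : R * n.-tuple E | climbs a b p.1 p.2])).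
  apply: measurableI; first exact: m1.
  apply: measurableU.
    exact: m1.
  rewrite -[X in measurable X]setTI; exact: (mnext measurableT _ IH).
apply/seteqP; split => -[s t] /=; case/tupleP: t => x t /=; rewrite tnth0.
  by move=> /andP[-> /orP[->|h]]; split=> //; [left|right].
by move=> [-> [->//|h]]; rewrite /= h orbT.
Qed.

Lemma measurable_climbs_from (a b : R) n (s : R) :
  measurable [set t : n.-tuple E | climbs a b s t].
Proof.
have := measurable_xsection s (@measurable_climbs a b n).
by congr measurable; apply/seteqP; split => t; rewrite /xsection /= inE.
Qed.

Definition climb_prob a b n s : R :=
  fine (product_prob nu n [set t | climbs a b s t]).

Lemma climb_prob_ge0 a b n s : 0 <= climb_prob a b n s.
Proof. exact: fine_ge0. Qed.

Lemma climb_probE a b n s :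
  product_prob nu n [set t | climbs a b s t] = (climb_prob a b n s)%:E.
Proof.
by rewrite fineK// fin_num_measure//; exact: measurable_climbs_from.
Qed.

Lemma climb_prob_le1 a b n s : climb_prob a b n s <= 1.
Proof.
rewrite -lee_fin -climb_probE; apply: probability_le1.
exact: measurable_climbs_from.
Qed.

Lemma climb_prob_step a b n s : - a <= s < b ->
  climb_prob a b n.+1 s = (\int[nu]_x climb_prob a b n (s + g x))%R.
Proof.
move=> /andP[sa sb]; rewrite /climb_prob /Rintegral/=; congr fine.
rewrite /distribution /pushforward /= /product_measure1.
apply: eq_integral => x _; rewrite /= fineK; last first.
  by rewrite fin_num_measure//; exact: measurable_climbs_from.
congr (product_prob nu n _); apply/seteqP; split => t; rewrite /xsection /= inE /=;
  by rewrite sa leNgt sb.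
Qed.

Let measurable_climb_prob a b n s :
  measurable_fun setT (fun x => climb_prob a b n (s + g x)).
Proof.
have m1 : measurable_fun setT
    (fun r => product_prob nu n [set t | climbs a b r t]).
  have := measurable_fun_xsection (product_prob nu n) (@measurable_climbs a b n).
  congr measurable_fun; apply/funext => r /=; congr (product_prob nu n _).
  by apply/seteqP; split => t; rewrite /xsection /= inE.
have m2 : measurable_fun setT (fun x => s + g x) by exact: measurable_funD.
exact: measurableT_comp (measurableT_comp (fine_measurable measurableT) m1) m2.
Qed.

(** The linear part is the harmonic function of the gambler's ruin, with the
    level b raised to b + C to account for the overshoot. The correction bounds
    the probability that n steps do not decide: M^2 - s^2 loses s2 on average at
    each step, hence at least the fraction s2 / M^2 of its value. *)
Definition ruin_profile a b M n s : R :=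
  (s + a) / (a + b + C) - (1 - s2 / M ^+ 2) ^+ n * (M ^+ 2 - s ^+ 2).

Let i1 (c : R) : nu.-integrable setT (EFin \o (fun x => c * g x)).
Proof.
apply: (eq_integrable measurableT _ _ _
  (integrableZl measurableT c (integrable_bounded nu mg gC))).
by move=> x _ /=; rewrite EFinM.
Qed.

Let ig2 : nu.-integrable setT (EFin \o (fun x => g x ^+ 2)).
Proof.
apply: (@integrable_bounded _ _ _ _ _ (C ^+ 2)) => [|x]; first exact: measurable_funX.
by rewrite normrX lerXn2r// nnegrE (le_trans _ (gC x)).
Qed.

Let i2 (c : R) : nu.-integrable setT (EFin \o (fun x => c * g x ^+ 2)).
Proof.
apply: (eq_integrable measurableT _ _ _ (integrableZl measurableT c ig2)).
by move=> x _ /=; rewrite EFinM.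
Qed.

Let i12 (c e : R) :
  nu.-integrable setT (EFin \o (fun x => c * g x + e * g x ^+ 2)).
Proof.
apply: (eq_integrable measurableT _ _ _ (integrableD measurableT (i1 c) (i2 e))).
by move=> x _ /=; rewrite EFinD.
Qed.

Let ruin_profileE a b M n s : (fun x => ruin_profile a b M n (s + g x)) =
  (fun x => ruin_profile a b M n s + (((a + b + C)^-1 +
     2 * (1 - s2 / M ^+ 2) ^+ n * s) * g x + (1 - s2 / M ^+ 2) ^+ n * g x ^+ 2)).
Proof. by apply/funext => x; rewrite /ruin_profile; ring. Qed.

Lemma integrable_ruin_profile a b M n s :
  nu.-integrable setT (EFin \o (fun x => ruin_profile a b M n (s + g x))).
Proof.
rewrite ruin_profileE.
have i0 := finite_measure_integrable_cst nu (ruin_profile a b M n s) measurableT.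
apply: (eq_integrable measurableT _ _ _ (integrableD measurableT i0 (i12 _ _))).
by move=> x _ /=; rewrite EFinD.
Qed.

Lemma integral_ruin_profile a b M n s :
  (\int[nu]_x ruin_profile a b M n (s + g x))%R =
  ruin_profile a b M n s + (1 - s2 / M ^+ 2) ^+ n * s2.
Proof.
rewrite ruin_profileE (RintegralD measurableT
  (finite_measure_integrable_cst nu _ measurableT) (i12 _ _)).
rewrite (RintegralD measurableT (i1 _) (i2 _)) (RintegralZl _ measurableT ig2).
rewrite (RintegralZl _ measurableT (integrable_bounded nu mg gC)).
rewrite Rintegral_cst// g_mean g_var.
rewrite [fine _](_ : _ = 1); last exact: (congr1 fine (probability_setT nu)).
by rewrite mulr0 add0r mulr1.
Qed.

(** By induction on n, as the profile is below its average after one step, and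
    below 0 or 1 once the walk has left the strip; before the first step it is
    negative since M^2 - s^2 >= 1. The range of s contains the strip and the
    points that one step out of it can reach. *)
Lemma climb_prob_ge_profile a b M n s : 0 <= a -> 0 < b -> 0 <= C ->
  a + C + 1 <= M -> b + C + 1 <= M -> 0 <= s2 <= M ^+ 2 ->
  - a - C <= s <= b + C -> ruin_profile a b M n s <= climb_prob a b n s.
Proof.
move=> a0 b0 C0 aM bM /andP[s20 s2M].
have w0 : 0 < a + b + C by lra.
have u1 r : r <= b + C -> (r + a) / (a + b + C) <= 1.
  by move=> sr; rewrite ler_pdivrMr// mul1r; lra.
have M1 r : - a - C <= r -> r <= b + C -> 1 <= M ^+ 2 - r ^+ 2.
  move=> sl sr; have : 0 <= (M - 1 - r) * (M - 1 + r) by apply: mulr_ge0; lra.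
  nra.
have M0 : 0 < M ^+ 2 by rewrite exprn_gt0//; lra.
have k0 n' : 0 <= (1 - s2 / M ^+ 2) ^+ n'.
  by rewrite exprn_ge0// subr_ge0 ler_pdivrMr// mul1r.
elim: n s => [|n IH] s /andP[sl sr];
  have u1s := u1 s sr; have M1s := M1 s sl sr.
  apply: le_trans (climb_prob_ge0 a b 0 s).
  by rewrite /ruin_profile expr0 mul1r; lra.
have km := mulr_ge0 (k0 n.+1) (le_trans ler01 M1s).
have [sa|sa] := ltP s (- a).
  apply: le_trans (climb_prob_ge0 a b n.+1 s).
  have : (s + a) / (a + b + C) <= 0 by rewrite ler_pdivrMr// mul0r; lra.
  by rewrite /ruin_profile; lra.
have [sb|sb] := leP b s.
  rewrite (_ : climb_prob a b n.+1 s = 1); first by rewrite /ruin_profile; lra.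
  apply: EFin_inj; rewrite -climb_probE -(probability_setT (product_prob nu n.+1)).
  congr (product_prob nu n.+1 _); apply/seteqP; split => // t _.
  by case/tupleP: t => x t; rewrite /mkset /= sa sb.
rewrite climb_prob_step ?sa ?sb//.
apply: (@le_trans _ _ (\int[nu]_x ruin_profile a b M n (s + g x))%R).
  rewrite integral_ruin_profile /ruin_profile exprSr -subr_ge0 [leRHS](_ : _ =
    (1 - s2 / M ^+ 2) ^+ n * (s2 * s ^+ 2 / M ^+ 2)); last first.
    by field; rewrite gt_eqF//; lra.
  apply: (mulr_ge0 (k0 n)); apply: divr_ge0 (ltW M0).
  exact: mulr_ge0 (sqr_ge0 s).
apply: le_Rintegral => //.
- exact: integrable_ruin_profile.
- apply: (@integrable_bounded _ _ _ _ _ 1) => // x.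
  by rewrite ger0_norm ?climb_prob_ge0// climb_prob_le1.
- move=> x _; apply: IH; have := gC x; rewrite ler_norml => /andP[g1 g2].
  by apply/andP; split; lra.
Qed.
End gambler.

(** * Independence of disjoint blocks of coordinates *)

Section tuple_measure.
Context d (T : measurableType d) (R : realType) (n : nat).

Definition rectangle (B : 'I_n -> set T) : set (n.-tuple T) :=
  [set t | forall i, B i (tnth t i)].

Lemma measurable_rectangle B : (forall i, measurable (B i)) ->
  measurable (rectangle B).
Proof.
move=> mB; rewrite (_ : rectangle B =
    \bigcap_(i : 'I_n) (@tnth n T ^~ i) @^-1` B i).
  apply: fin_bigcap_measurable => // i _; rewrite -[X in measurable X]setTI.
  exact: measurable_tnth.
by apply/seteqP; split => [t h i _|t h i]; exact: h.
Qed.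

(** Rectangles form a pi-system that generates the product sigma-algebra. *)
Lemma tuple_measure_unique (m1 m2 : {measure set (n.-tuple T) -> \bar R}) :
  (forall B, (forall i, measurable (B i)) ->
     m1 (rectangle B) = m2 (rectangle B)) ->
  (m1 setT < +oo)%E -> forall A, measurable A -> m1 A = m2 A.
Proof.
move=> m12 m1oo.
pose G : set (set (n.-tuple T)) :=
  [set A | exists2 B, (forall i, measurable (B i)) & A = rectangle B].
have rectT : rectangle (fun=> setT) = setT by apply/seteqP; split.
apply: (measure_unique G (fun=> setT)) => //.
- apply/seteqP; split.
  + apply: smallest_sub; first exact: smallest_sigma_algebra.
    elim/big_ind: _ => [//|A B hA hB|i _]; first by rewrite subUset.
    move=> _ [B mB <-]; apply: sub_sigma_algebra.
    exists (fun j => if j == i then B else setT); first by move=> j; case: ifP.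
    rewrite setTI; apply/seteqP; split => [t Bt j|t /(_ i)]; last by rewrite eqxx.
    by case: eqP => // ->.
  + apply: smallest_sub; first exact: sigma_algebra_measurable.
    by move=> _ [B mB ->]; exact: measurable_rectangle.
- move=> _ _ [B mB ->] [B' mB' ->]; exists (fun i => B i `&` B' i).
    by move=> i; exact: measurableI.
  apply/seteqP; split => [t [h h'] i|t h]; first by split.
  by split => i; case: (h i).
- by move=> _; exists (fun=> setT).
- by rewrite bigcup_const.
- by move=> _ [B mB ->]; exact: m12.
Qed.
End tuple_measure.

Section restricted_law.
Context d d' (T : measurableType d) (T' : measurableType d') (R : realType)
  (P : probability T R) (H : set T) (f : T -> T').
Hypothesis mH : measurable H.
Hypothesis mf : measurable_fun setT f.

(** The law of f on the event H, not normalized. It is a measure, to which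
    [tuple_measure_unique] applies even when H is a null event. *)
Definition restricted_law (E : set T') := P (f @^-1` E `&` H).

Let mfE E : measurable E -> measurable (f @^-1` E).
Proof. by move=> mE; rewrite -[X in measurable X]setTI; exact: mf. Qed.

Let restricted_law0 : restricted_law set0 = 0%E.
Proof. by rewrite /restricted_law preimage_set0 set0I measure0. Qed.

Let restricted_law_ge0 E : (0 <= restricted_law E)%E.
Proof. exact: measure_ge0. Qed.

Let restricted_law_sigma_additive : semi_sigma_additive restricted_law.
Proof.
move=> F mF tF mUF; rewrite /restricted_law preimage_bigcup setI_bigcupl.
apply: measure_semi_sigma_additive.
- by move=> n; apply: measurableI => //; exact: mfE.
- apply/trivIsetP => /= i j _ _ ij; rewrite setIACA -preimage_setI.
  by move/trivIsetP : tF => /(_ _ _ _ _ ij) ->//; rewrite preimage_set0 set0I.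
- by rewrite -setI_bigcupl -preimage_bigcup; apply: measurableI => //; exact: mfE.
Qed.

HB.instance Definition _ := isMeasure.Build _ _ _ restricted_law
  restricted_law0 restricted_law_ge0 restricted_law_sigma_additive.

Definition restricted_law_measure : {measure set T' -> \bar R} := restricted_law.

End restricted_law.

Section block_independence.
Context dO (Om : measurableType dO) d (T : measurableType d) (R : realType)
  (P : probability Om R) (I : choiceType) (omega : I -> {RV P >-> T})
  (mu : probability T R).
Hypothesis indep : independent_RVs omega.
Hypothesis law : forall x A, measurable A -> P (omega x @^-1` A) = mu A.

Lemma prob_coordinates (K : seq I) (A : I -> set T) : uniq K ->
  (forall x, x \in K -> measurable (A x)) ->
  P [set w | forall x, x \in K -> A x (omega x w)] =
  (\prod_(x <- K) mu (A x))%E.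
Proof.
move=> uK mA; have := @indep [fset x in K]%fset (fun x => omega x @^-1` A x).
have -> : \bigcap_(x in [set` [fset x in K]%fset]) (omega x @^-1` A x) =
    [set w | forall x, x \in K -> A x (omega x w)].
  by apply/seteqP; split => w h x xK; apply: h; move: xK; rewrite /= inE.
move=> ->; last first.
  by move=> x; rewrite inE => xK; exists (A x); [exact: mA|rewrite setTI].
rewrite (perm_big K); last first.
  by apply: uniq_perm => //= x; rewrite inE.
by rewrite big_seq [RHS]big_seq; apply: eq_bigr => x xK; rewrite law//; exact: mA.
Qed.

Context (f : nat -> nat -> I) (n : nat -> nat).
Hypothesis f_inj : forall b i b' i', (i < n b)%N -> (i' < n b')%N ->
  f b i = f b' i' -> b = b' /\ i = i'.

Definition block b (w : Om) : (n b).-tuple T := [tuple omega (f b i) w | i < n b].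

Lemma measurable_block b : measurable_fun setT (block b).
Proof.
apply/measurable_fun_tnthP => i.
rewrite (_ : _ \o _ = omega (f b i)); first exact: measurable_funP.
by apply/funext => w /=; rewrite tnth_mktuple.
Qed.

Definition block_event (J : seq nat) (D : forall b, set ((n b).-tuple T))
    (K : seq I) (A : I -> set T) : set Om :=
  [set w | (forall b, b \in J -> D b (block b w)) /\
           (forall x, x \in K -> A x (omega x w))].

Lemma measurable_block_event J D K A : (forall b, measurable (D b)) ->
  (forall x, x \in K -> measurable (A x)) -> measurable (block_event J D K A).
Proof.
move=> mD mA; rewrite (_ : block_event J D K A =
  (\bigcap_(b in [set b | b \in J]) (block b @^-1` D b)) `&`
  \bigcap_(x in [set` K]) (omega x @^-1` A x)); last by [].
apply: measurableI.
  apply: bigcap_measurableType => b _; rewrite -[X in measurable X]setTI.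
  exact: (measurable_block measurableT (mD b)).
apply: fin_bigcap_measurable => [|x xK]; first exact: finite_seq.
rewrite -[X in measurable X]setTI.
by apply: measurable_funP => //; exact: mA.
Qed.

(** The coordinates in K, outside the blocks of J, make the induction on J work:
    by uniqueness of measures the event D b on one block may be replaced by a
    rectangle, and the coordinates of that block then move to K. *)
Lemma prob_block_event J D K A : uniq J -> uniq K ->
  (forall b, measurable (D b)) -> (forall x, x \in K -> measurable (A x)) ->
  (forall b i, b \in J -> (i < n b)%N -> f b i \notin K) ->
  P (block_event J D K A) =
  (\prod_(b <- J) product_prob mu (n b) (D b) * \prod_(x <- K) mu (A x))%E.
Proof.
move=> + + mD; elim: J K A => [|b J IH] K A /=.
  move=> _ uK mA _; rewrite big_nil mul1e -prob_coordinates//.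
  by congr (P _); apply/seteqP; split => [w []|w h].
move=> /andP[bJ uJ] uK mA JK.
set H := block_event J D K A.
have mH : measurable H by exact: measurable_block_event.
have JK' b' i : b' \in J -> (i < n b')%N -> f b' i \notin K.
  by move=> b'J; apply: JK; rewrite inE b'J orbT.
have PH := IH K A uJ uK mA JK'.
have -> : block_event (b :: J) D K A = block b @^-1` (D b) `&` H.
  apply/seteqP; split => [w [h1 h2]|w [h1 [h2 h3]]].
    split; first by apply: h1; rewrite inE eqxx.
    by split => // b' b'J; apply: h1; rewrite inE b'J orbT.
  by split => // b'; rewrite inE => /orP[/eqP ->//|]; exact: h2.
have c0 : 0 <= fine (P H) by exact: fine_ge0.
have PHE : P H = (NngNum c0)%:num%:E by rewrite /= fineK// fin_num_measure.
have mb := @measurable_block b.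
pose m1 := restricted_law_measure P mH mb.
pose m2 := mscale (NngNum c0) (product_prob mu (n b)).
rewrite big_cons -muleA -PH muleC -/H PHE.
suff : m1 (D b) = m2 (D b) by [].
apply: tuple_measure_unique; last exact: mD; last first.
  rewrite /m1 /= /restricted_law ltey_eq fin_num_measure//; apply: measurableI => //.
  by rewrite preimage_setT.
move=> B mB; rewrite /m1 /m2 /= /mscale -PHE /restricted_law.
transitivity (P H * \prod_i mu (B i))%E; last first.
  by congr (_ * _)%E; exact: esym (product_probE mu mB).
pose K' := [seq f b i | i : 'I_(n b)] ++ K.
pose A' x := [set y | (x \in K -> A x y) /\ forall i : 'I_(n b), f b i = x -> B i y].
have A'K x : x \in K -> A' x = A x.
  move=> xK; apply/seteqP; split => [y [/(_ xK)]//|y Ay]; split => // i fx.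
  by have := @JK b i; rewrite inE eqxx fx xK => /(_ isT (ltn_ord i)).
have A'B (i : 'I_(n b)) : A' (f b i) = B i.
  apply/seteqP; split => [y [_ /(_ i erefl)]//|y By]; split.
    by have := @JK b i; rewrite inE eqxx => /(_ isT (ltn_ord i)) /negbTE ->.
  by move=> j /f_inj[]// _ ji; rewrite (_ : j = i)//; apply: val_inj.
have -> : block b @^-1` rectangle B `&` H = block_event J D K' A'.
  apply/seteqP; split => w.
    move=> [h1 [h2 h3]]; split => // x; rewrite mem_cat => /orP[|xK].
      by case/mapP => i _ ->; rewrite A'B; have := h1 i; rewrite tnth_mktuple.
    by rewrite A'K//; exact: h3.
  move=> [h1 h2]; split; last first.
    by split => // x xK; rewrite -(A'K x)//; apply: h2; rewrite mem_cat xK orbT.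
  move=> i; rewrite -A'B tnth_mktuple; apply: h2; rewrite mem_cat; apply/orP; left.
  by apply/mapP; exists i; rewrite ?mem_enum.
rewrite IH//.
- rewrite big_cat/= big_map big_enum/= PH -muleA; congr (_ * _)%E.
  rewrite [RHS]muleC; congr (_ * _)%E; first by apply: eq_bigr => i _; rewrite A'B.
  by rewrite big_seq [RHS]big_seq; apply: eq_bigr => x xK; rewrite A'K.
- rewrite cat_uniq uK andbT; apply/andP; split.
    rewrite map_inj_uniq ?enum_uniq// => i j /f_inj[]// _ ij; exact: val_inj.
  apply/hasPn => x xK; apply/mapP => -[i _ xE]; have := JK b i.
  by rewrite inE eqxx -xE xK => /(_ isT (ltn_ord i)).
- move=> x; rewrite mem_cat => /orP[|xK]; last by rewrite A'K//; exact: mA.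
  by case/mapP => i _ ->; rewrite A'B.
- move=> b' i b'J ib'; rewrite mem_cat negb_or JK'// andbT.
  apply/mapP => -[j _ /f_inj[]// b'b _].
  by move: bJ; rewrite -b'b b'J.
Qed.

End block_independence.

(** * The second Borel-Cantelli lemma *)

(** A bound of (1 - x)^k by 1 / (1 + k x): Bernoulli's inequality with a
    negative exponent. *)
Lemma bernoulli_decay (R : realFieldType) (x : R) k : 0 <= x -> x <= 1 ->
  (1 - x) ^+ k * (1 + k%:R * x) <= 1.
Proof.
move=> x0 x1; elim: k => [|k IH]; first by rewrite expr0 mul0r addr0 mulr1.
apply: le_trans IH; rewrite exprSr -mulrA ler_wpM2l ?exprn_ge0 ?subr_ge0//.
rewrite -natr1 -subr_ge0 [leRHS](_ : _ = (k%:R + 1) * (x * x)); last by ring.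
by rewrite !mulr_ge0.
Qed.

Section second_borel_cantelli.
Context d (T : measurableType d) (R : realType) (P : probability T R)
  (E : nat -> set T).
Hypothesis mE : forall j, measurable (E j).
Hypothesis indE : forall J : seq nat, uniq J ->
  P [set t | forall j, j \in J -> E j t] = (\prod_(j <- J) P (E j))%E.

Let hits_misses (J J' : seq nat) : set T :=
  [set t | (forall j, j \in J -> E j t) /\ (forall j, j \in J' -> ~ E j t)].

Let measurable_hits_misses J J' : measurable (hits_misses J J').
Proof.
rewrite (_ : hits_misses J J' = (\bigcap_(j in [set j | j \in J]) E j) `&`
  \bigcap_(j in [set j | j \in J']) ~` E j); last by [].
by apply: measurableI; apply: bigcap_measurableType => j _ //; exact: measurableC.
Qed.

(** The product rule extends to complements by induction on the list of
    complemented events, since P (A minus E) = P A - P (A meet E). *)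
Let prob_hits_misses J J' : uniq (J' ++ J) -> P (hits_misses J J') =
  (\prod_(j <- J) fine (P (E j)) * \prod_(j <- J') (1 - fine (P (E j))))%:E.
Proof.
elim: J' J => [|b J' IH] J /=.
  move=> uJ; rewrite big_nil mulr1 -prodEFin.
  rewrite (_ : hits_misses J [::] = [set t | forall j, j \in J -> E j t]); last first.
    by apply/seteqP; split => [t []|t h].
  by rewrite indE//; apply: eq_bigr => j _; rewrite fineK// fin_num_measure.
move=> /andP[bJ uJ].
have h1 := IH J uJ; have uJb : uniq (J' ++ b :: J).
  by rewrite -cat1s uniq_catCA /= bJ.
have h2 := IH (b :: J) uJb.
have h3 : P (hits_misses J J') =
    (P (hits_misses J J' `\` E b) + P (hits_misses J J' `&` E b))%E.
  exact: measureDI.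
have e1 : hits_misses J J' `\` E b = hits_misses J (b :: J').
  apply/seteqP; split => [t [[h h'] nb]|t [h h']].
    by split => // j; rewrite inE => /orP[/eqP ->|/h'].
  split; last by apply: h'; rewrite inE eqxx.
  by split => // j jJ; apply: h'; rewrite inE jJ orbT.
have e2 : hits_misses J J' `&` E b = hits_misses (b :: J) J'.
  apply/seteqP; split => [t [[h h'] nb]|t [h h']].
    by split => // j; rewrite inE => /orP[/eqP ->|/h].
  split; last by apply: h; rewrite inE eqxx.
  by split => // j jJ; apply: h; rewrite inE jJ orbT.
move: h3; rewrite e1 e2 h1 h2 !big_cons.
rewrite -[P (hits_misses _ (b :: J'))]fineK; last first.
  by rewrite fin_num_measure.
by rewrite -EFinD => -[] h; congr (_%:E); lra.
Qed.

Lemma second_borel_cantelli (c : R) : 0 < c -> (forall j, (c%:E <= P (E j))%E) ->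
  {ae P, forall t, forall m, exists2 j, (m <= j)%N & E j t}.
Proof.
move=> c0 cE.
have fp1 j : fine (P (E j)) <= 1.
  by rewrite -lee_fin fineK ?fin_num_measure// probability_le1.
have fpc j : c <= fine (P (E j)).
  by rewrite -lee_fin fineK ?fin_num_measure.
have c1 : c <= 1 := le_trans (fpc 0%N) (fp1 0%N).
pose N m : set T := \bigcap_k hits_misses [::] (iota m k).
have mN m : measurable (N m) by exact: bigcap_measurableType.
have PN m : P (N m) = 0%E.
  have PNk k : fine (P (N m)) <= (1 - c) ^+ k.
    rewrite -lee_fin fineK ?fin_num_measure//.
    apply: (@le_trans _ _ (P (hits_misses [::] (iota m k)))).
      by apply: le_measure; rewrite ?inE// => t; apply.
    rewrite prob_hits_misses ?cats0 ?iota_uniq// big_nil mul1r lee_fin.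
    rewrite -[k in leRHS](size_iota m); elim: (iota m k) => [|j s IH].
      by rewrite big_nil.
    rewrite big_cons exprS; apply: ler_pM => //; first by rewrite subr_ge0 fp1.
      by rewrite big_seq; apply: prodr_ge0 => i _; rewrite subr_ge0 fp1.
    by rewrite lerB// fpc.
  apply/eqP; rewrite eq_le measure_ge0 andbT -[P _]fineK ?fin_num_measure// lee_fin.
  rewrite leNgt; apply/negP => p0.
  set p := fine (P (N m)) in p0 PNk *.
  have pc0 : 0 < p * c by exact: mulr_gt0.
  have kp : (p * c)^-1 < (Num.bound (p * c)^-1)%:R.
    by apply: archi_boundP; rewrite invr_ge0 ltW.
  set k := Num.bound _ in kp.
  have h1 : p * (1 + k%:R * c) <= 1.
    apply: le_trans (bernoulli_decay k (ltW c0) c1).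
    by apply: ler_wpM2r (PNk k); rewrite addr_ge0// mulr_ge0// ltW.
  have : 1 < p * c * k%:R by rewrite -(ltr_pM2l pc0) mulfV ?gt_eqF in kp.
  lra.
have NN m : P.-negligible (N m) by apply/(negligibleP P); [exact: mN|exact: PN].
apply: negligibleS (negligible_bigcup NN) => t /= /existsNP[m hm].
exists m => // k _; split => // j; rewrite mem_iota => /andP[mj _] Ej.
by apply: hm; exists j.
Qed.
End second_borel_cantelli.

(** * Divergence of the series from arbitrarily deep valleys *)

Section divergence.
Context (R : realType).

(** The width of a valley at scale L will be of order L^4; a fifth power
    dominates it. *)
Lemma expR_ge_pow5 (x : R) : 0 <= x -> (x / 5) ^+ 5 <= expR x.
Proof.
move=> x0; rewrite [in leRHS](_ : x = 5 * (x / 5)); last by rewrite mulrC divfK.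
rewrite expRM_natl lerXn2r ?nnegrE ?expR_ge0 ?divr_ge0//.
by apply: le_trans (expR_ge1Dx _); rewrite lerDr.
Qed.

(** Up to a factor, exp (- potential om x) is the conductance of the edge between
    x and x + 1 in the electrical network of the reversible walk. *)
Definition potential (om : int -> R) (x : int) : R :=
  match x with
  | Posz n => \sum_(i < n) ln (rho (om i.+1%:Z))
  | Negz n => - \sum_(i < n.+1) ln (rho (om (- i%:Z)))
  end.

Lemma potential0 om : potential om 0 = 0.
Proof. exact: big_ord0. Qed.

Lemma potentialN om n : potential om (- n%:Z) = - \sum_(i < n) ln (rho (om (- i%:Z))).
Proof. by case: n => [|n //]; rewrite big_ord0 !oppr0; exact: potential0. Qed.

Lemma potentialB om x : potential om x - potential om (x - 1) = ln (rho (om x)).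
Proof.
case: x => [[|n]|n].
- by rewrite potential0 sub0r (potentialN om 1) opprK big_ord1 oppr0.
- rewrite (_ : n.+1%:Z - 1 = n%:Z); last by lia.
  by rewrite /potential big_ord_recr/= addrAC subrr add0r.
- rewrite NegzE (_ : - n.+1%:Z - 1 = - n.+2%:Z); last by lia.
  by rewrite !potentialN [in X in _ - X]big_ord_recr/= opprK addKr.
Qed.

(** The bound on the width turns the factor A + B + 1 of [valley_return_ge] into
    exp h. *)
Definition has_valley (om : int -> R) (h L : R) := exists A B : nat,
  [/\ forall x, - A%:Z <= x <= B%:Z -> - h <= potential om x,
      L <= potential om (- A%:Z), L <= potential om B%:Z &
      (A + B).+1%:R <= expR h].

Lemma valley_return_exp om (eps h L : R) n : (forall x, 0 < om x < 1) ->
  0 < eps -> (forall x, eps <= om x <= 1 - eps) -> has_valley om h L ->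
  4 * n%:R <= eps * expR L -> eps / 4 * expR (- (2 * h)) <= return_prob om n.*2 0.
Proof.
move=> om01 eps0 ell [A [B [Vh VA VB AB]]] nL.
have := valley_return_ge om01 (potential0 om) (potentialB om) eps0 ell Vh VA VB nL.
move=> H; have r0 := return_prob_ge0 om01 n.*2 0.
set r := return_prob _ _ _ in H r0 *.
have e0 := expR_gt0 h.
have : eps <= 4 * expR h * expR h * r.
  apply: le_trans H _; rewrite ler_wpM2r// ler_pM2r// ler_pM2l//.
rewrite expRN (_ : expR (2 * h) = expR h * expR h); last by rewrite -expRD mulr_natl mulr2n.
move=> H2; rewrite ler_pdivrMr ?mulr_gt0// -[leLHS]mulrC; rewrite ler_pdivrMl//.
by lra.
Qed.

(** With h = L / (4 d), each factor is at least (eps / 4) exp (- L / (2 d)) for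
    n up to (eps / 4) exp L, so these n contribute to the sum at least
    a constant times exp (L / 2). *)
Lemma sum_return_pinfty (d : nat) (om : 'I_d -> int -> R) (eps : R) : (0 < d)%N ->
  (forall k x, 0 < om k x < 1) -> 0 < eps ->
  (forall k x, eps <= om k x <= 1 - eps) ->
  (forall m : R, exists2 L, m <= L &
     forall k, has_valley (om k) (L / (4 * d%:R)) L) ->
  (\sum_(1 <= n <oo) \prod_(k < d) (return_prob (om k) n.*2 0)%:E = +oo)%E.
Proof.
move=> d0 om01 eps0 ell val; apply: eq_infty => r.
set e4 := eps / 4; have e40 : 0 < e4 by rewrite divr_gt0.
have ed0 : 0 < e4 ^+ d by exact: exprn_gt0.
(* For L >= m, e4 * exp (L / 2) exceeds |r| / e4^d + 1, since exp x >= 1 + x. *)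
pose m : R := Num.max 0 (2 * ((`|r| / e4 ^+ d + 1) / e4)).
have [L mL valL] := val m.
have L0 : 0 <= L by apply: le_trans mL; rewrite le_max lexx.
have Lr : 2 * ((`|r| / e4 ^+ d + 1) / e4) <= L.
  by apply: le_trans mL; rewrite le_max lexx orbT.
pose N := Num.truncn (e4 * expR L).
have NL : N%:R <= e4 * expR L.
  by rewrite truncn_le// mulr_ge0 ?expR_ge0// ltW.
have NL1 : e4 * expR L < N.+1%:R by exact: truncnS_gt.
have term n : (n <= N)%N -> e4 ^+ d * expR (- (L / 2)) <=
    \prod_(k < d) return_prob (om k) n.*2 0.
  move=> nN; rewrite (_ : expR (- (L / 2)) = expR (- (2 * (L / (4 * d%:R)))) ^+ d); last first.
    rewrite -expRM_natl; congr expR; rewrite -mulr_natr; field.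
    by rewrite pnatr_eq0 -lt0n.
  rewrite -exprMn -[X in _ ^+ X]card_ord -prodr_const; apply: ler_prod => k _.
  rewrite mulr_ge0 ?expR_ge0 ?(ltW e40)//=.
  apply: (valley_return_exp (om01 k) eps0 (ell k) (valL k)).
  have : n%:R <= e4 * expR L by apply: le_trans NL; rewrite ler_nat.
  by rewrite /e4; lra.
apply: (@le_trans _ _ (\sum_(1 <= n < N.+1) \prod_(k < d) (return_prob (om k) n.*2 0)%:E)%E);
  last first.
  apply: nneseries_lim_ge => n _ _; rewrite prodEFin lee_fin.
  by apply: prodr_ge0 => k _; exact: return_prob_ge0.
under eq_bigr do rewrite prodEFin.
rewrite sumEFin lee_fin.
apply: (@le_trans _ _ (\sum_(1 <= n < N.+1) e4 ^+ d * expR (- (L / 2)))); last first.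
  rewrite big_nat [leRHS]big_nat; apply: ler_sum => n /andP[_ nN]; exact: term.
rewrite sumr_const_nat subn1 -[_ *+ N]mulr_natr -mulrA -ler_pdivrMl//.
rewrite expRN; set E := expR (L / 2).
have EE : expR L = E * E by rewrite -expRD; congr expR; field.
have E1 : 1 + L / 2 <= E by exact: expR_ge1Dx.
have E0 : 0 < E by exact: expR_gt0.
rewrite mulrC ler_pdivlMl//.
move: NL1; rewrite EE -natr1 => NL1.
have rr : r / e4 ^+ d <= `|r| / e4 ^+ d by rewrite ler_pM2r ?invr_gt0// ler_norm.
have E2 : `|r| / e4 ^+ d + 1 <= e4 * E.
  rewrite [leRHS]mulrC -ler_pdivrMr//; lra.
have E3 : 1 <= E by lra.
have := ler_wpM2l (ltW E0) (le_trans (lerD rr (lexx 1)) E2); lra.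
Qed.

End divergence.

(** * Valleys from climbs of the potential on both sides *)

Lemma climbs_witness (R : realType) dE (E : measurableType dE) (g : E -> R)
    (a b s : R) (x0 : E) t :
  climbs g a b s t -> exists2 n, (n <= size t)%N &
    b <= s + \sum_(i < n) g (nth x0 t i) /\
    forall m, (m <= n)%N -> - a <= s + \sum_(i < m) g (nth x0 t i).
Proof.
elim: t s => [|x t IH] s /=; rewrite ?orbF => /andP[sa].
  move=> sb; exists 0%N => //; rewrite big_ord0 addr0; split => // m.
  by rewrite leqn0 => /eqP ->; rewrite big_ord0 addr0.
move=> /orP[sb|/IH[n nt [nb na]]].
  exists 0%N => //; rewrite big_ord0 addr0; split => // m.
  by rewrite leqn0 => /eqP ->; rewrite big_ord0 addr0.
exists n.+1 => //; split => [|[_|m mn]].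
- by rewrite big_ord_recl /= addrA.
- by rewrite big_ord0 addr0.
- by rewrite big_ord_recl /= addrA; exact: na.
Qed.

Section valley_of_climbs.
Context (R : realType).

(** The steps of the potential on the right of the origin ([true]) are
    ln rho at 1, 2, 3 and so on; on the left ([false]) they are - ln rho at
    0, -1, -2 and so on. The two sides share no site. *)
Definition site (s : bool) (i : nat) : int := if s then i.+1%:Z else - i%:Z.

Definition side_sign (s : bool) : R := if s then 1 else -1.

Definition side_walk (om : int -> R) s n : R :=
  \sum_(i < n) side_sign s * ln (rho (om (site s i))).

(** It agrees with ln (rho p) on elliptic environments, and it is bounded
    everywhere, as the gambler's ruin estimate requires of the steps. *)
Definition clipped_log_rho (eps p : R) : R :=
  if eps <= p <= 1 - eps then ln (1 - p) - ln p else 0.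

Lemma clipped_log_rhoE (eps p : R) : 0 < eps -> eps <= p <= 1 - eps ->
  clipped_log_rho eps p = ln (rho p).
Proof.
move=> e0 /[dup] pe; rewrite /clipped_log_rho => ->; case/andP: pe => pe1 pe2.
by rewrite /rho ln_div ?posrE; lra.
Qed.

Lemma clipped_log_rho_le (eps p : R) : 0 < eps < 2^-1 ->
  `|clipped_log_rho eps p| <= - ln eps.
Proof.
move=> /andP[e0 e1]; rewrite /clipped_log_rho; case: ifP => [/andP[p1 p2]|_].
  have h1 : ln eps <= ln p by rewrite ler_ln ?posrE; lra.
  have h2 : ln eps <= ln (1 - p) by rewrite ler_ln ?posrE; lra.
  have h3 : ln p <= 0 by apply: ln_le0; lra.
  have h4 : ln (1 - p) <= 0 by apply: ln_le0; lra.
  by rewrite ler_norml; lra.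
by rewrite normr0 oppr_ge0; apply: ln_le0; lra.
Qed.

Lemma potential_side om s n :
  potential om (if s then n%:Z else - n%:Z) = side_walk om s n.
Proof.
case: s; first by apply: eq_bigr => i _; rewrite mul1r.
rewrite potentialN /side_walk -sumrN; apply: eq_bigr => i _.
by rewrite mulN1r.
Qed.

(** The first r steps move the potential by at most C r; a climb of the next N
    steps from its value at r is thus a climb from 0 up to this error. *)
Lemma side_walk_climb (om : int -> R) (eps C : R) r N (a b : R) s : 0 < eps < 2^-1 ->
  (forall x, eps <= om x <= 1 - eps) -> C = - ln eps -> 0 <= a ->
  climbs (fun p => side_sign s * clipped_log_rho eps p) a b 0
    [seq om (site s (r + i)) | i <- iota 0 N] ->
  exists2 B, (B <= r + N)%N &
    (forall n, (n <= B)%N -> - (a + C * r%:R) <= side_walk om s n) /\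
    b - C * r%:R <= side_walk om s B.
Proof.
move=> e01 ell CE a0 /(climbs_witness (0 : R))[n]; have [e0 e1] := andP e01.
rewrite size_map size_iota => nN [nb na].
have lC x : `|ln (rho (om x))| <= C.
  by rewrite -(clipped_log_rhoE e0 (ell x)) CE clipped_log_rho_le.
have C0 : 0 <= C by apply: le_trans (lC 0).
have WE m : (m <= n)%N -> side_walk om s (r + m) = side_walk om s r +
    \sum_(i < m) side_sign s * clipped_log_rho eps
      (nth 0 [seq om (site s (r + i)) | i <- iota 0 N] i).
  move=> mn; rewrite /side_walk big_split_ord/=; congr (_ + _).
  apply: eq_bigr => i _; have iN : (i < N)%N by have := ltn_ord i; lia.
  rewrite (nth_map 0%N) ?size_iota// nth_iota// add0n.
  by rewrite clipped_log_rhoE.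
have Wr m : `|side_walk om s m| <= C * m%:R.
  apply: le_trans (ler_norm_sum _ _ _) _.
  rewrite -[m in leRHS]card_ord mulr_natr -sumr_const; apply: ler_sum => i _.
  rewrite normrM; case: s {WE na nb} => /=; rewrite ?normrN normr1 mul1r; exact: lC.
exists (r + n)%N; first by rewrite leq_add2l.
have := Wr r; rewrite ler_norml => /andP[Wr1 Wr2]; split; last first.
  by rewrite WE//; lra.
move=> m mB; have [mr|rm] := leqP m r.
  have := Wr m; rewrite ler_norml => /andP[Wm1 _].
  have : C * m%:R <= C * r%:R by rewrite ler_wpM2l// ler_nat.
  lra.
rewrite -(subnKC (ltnW rm)) WE; last by lia.
by have := na (m - r)%N; rewrite leq_subLR add0r => /(_ mB); lra.
Qed.

Lemma valley_of_climbs (om : int -> R) (eps C : R) r N (a b h L : R) : 0 < eps < 2^-1 ->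
  (forall x, eps <= om x <= 1 - eps) -> C = - ln eps -> 0 <= a ->
  (forall s, climbs (fun p => side_sign s * clipped_log_rho eps p) a b 0
    [seq om (site s (r + i)) | i <- iota 0 N]) ->
  a + C * r%:R <= h -> L <= b - C * r%:R ->
  (2 * (r + N)).+1%:R <= expR h -> has_valley om h L.
Proof.
move=> e01 ell CE a0 cl ah Lb wh.
have [B BN [WB Bb]] := side_walk_climb e01 ell CE a0 (cl true).
have [A AN [WA Ab]] := side_walk_climb e01 ell CE a0 (cl false).
exists A, B; split.
- move=> x /andP[xA xB]; have [x0|x0] := leP 0 x.
    have xn : (absz x <= B)%N by lia.
    have := WB _ xn; rewrite -(potential_side _ true) (_ : (absz x)%:Z = x); last by lia.
    lra.
  have xn : (absz x <= A)%N by lia.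
  have := WA _ xn; rewrite -(potential_side _ false) (_ : - (absz x)%:Z = x); last by lia.
  lra.
- by rewrite (potential_side _ false); lra.
- by rewrite (potential_side _ true); lra.
- by apply: le_trans wh; rewrite ler_nat ltnS mul2n -addnn leq_add.
Qed.

(** For a = dl L / 2, b = 2 L and C <= L, the linear part a / (a + b + C) of the
    gambler's ruin bound is at least dl / (2 (dl + 6)). Half of it remains after
    a number N of steps of order M^4, with M = 2 L + C + 1. As L may be taken
    large with respect to r, so is exp (dl L) with respect to r + N. *)
Lemma scale_exists (C s2 dl : R) (r : nat) : 0 <= C -> 0 < s2 -> 0 < dl <= 1 ->
  exists L N, [/\ (r%:R + 1 <= L), (0 < N)%N, C * r%:R <= dl * L / 2,
    (2 * (r + N)).+1%:R <= expR (dl * L) &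
    dl / (4 * (dl + 6)) <= ruin_profile C s2 (dl * L / 2) (2 * L) (2 * L + C + 1) N 0
    /\ s2 <= (2 * L + C + 1) ^+ 2 /\ C <= L].
Proof.
move=> C0 s20 /andP[dl0 dl1].
set c := dl / (4 * (dl + 6)).
have c0 : 0 < c by rewrite divr_gt0// mulr_gt0//; lra.
have dl5 : 0 < (dl / 5) ^+ 5 by rewrite exprn_gt0// divr_gt0.
pose K := 2 * 256 / (s2 * c).
have K0 : 0 < K by rewrite /K; apply: divr_gt0; [lra|exact: mulr_gt0].
(* Each summand is one of the quantities that L has to dominate. *)
pose L := r%:R + 1 + C + s2 + 2 * C * r%:R / dl + (K + 8) / (dl / 5) ^+ 5.
have t1 : 0 <= 2 * C * r%:R / dl by rewrite divr_ge0 ?mulr_ge0// ltW.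
have t2 : 0 <= (K + 8) / (dl / 5) ^+ 5 by rewrite divr_ge0 ?(ltW dl5)//; lra.
have r0 : 0 <= r%:R :> R by [].
have Lr : r%:R + 1 <= L by rewrite /L; lra.
have LC : C <= L by rewrite /L; lra.
have Ls : s2 <= L by rewrite /L; lra.
have L1 : 1 <= L by lra.
have Lt1 : 2 * C * r%:R / dl <= L by rewrite /L; lra.
have Lt2 : (K + 8) / (dl / 5) ^+ 5 <= L by rewrite /L; lra.
clearbody L; set M := 2 * L + C + 1.
have M4 : M <= 4 * L by rewrite /M; lra.
have M1 : 1 <= M by rewrite /M; lra.
have M20 : 0 < M ^+ 2 by rewrite exprn_gt0//; lra.
have s2M : s2 <= M ^+ 2.
  apply: (@le_trans _ _ M); first by rewrite /M; lra.
  by rewrite expr2 ler_peMr//; lra.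
pose N := (Num.truncn (M ^+ 4 / (s2 * c))).+1.
have N1 : M ^+ 4 / (s2 * c) < N%:R by exact: truncnS_gt.
have N2 : N%:R <= M ^+ 4 / (s2 * c) + 1.
  rewrite /N -natr1 lerD2r truncn_le//; apply: divr_ge0; last exact: ltW (mulr_gt0 s20 c0).
  by apply: exprn_ge0; lra.
have M44 : M ^+ 4 <= 256 * L ^+ 4.
  rewrite (_ : 256 = 4 ^+ 4); last by ring.
  by rewrite -exprMn lerXn2r ?nnegrE//; lra.
exists L, N; split => //.
- by rewrite ler_pdivrMr // in Lt1; lra.
- apply: le_trans (expR_ge_pow5 _); last by rewrite mulr_ge0//; lra.
  rewrite [leRHS](_ : _ = (dl / 5) ^+ 5 * L * L ^+ 4); last by field.
  have LK : K + 8 <= (dl / 5) ^+ 5 * L by rewrite mulrC -ler_pdivrMr.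
  apply: (@le_trans _ _ ((K + 8) * L ^+ 4)); last first.
    by rewrite ler_wpM2r// exprn_ge0//; lra.
  have L4 : L <= L ^+ 4 by rewrite exprS ler_peMr ?exprn_ege1//; lra.
  have L41 : 1 <= L ^+ 4 by lra.
  have N3 : N%:R <= K / 2 * L ^+ 4 + 1.
    apply: le_trans N2 _; rewrite lerD2r.
    rewrite [leRHS](_ : _ = 256 * L ^+ 4 / (s2 * c)); last first.
      by rewrite /K; field; rewrite !gt_eqF.
    by rewrite ler_pM2r// invr_gt0 mulr_gt0.
  rewrite -natr1 natrM natrD; lra.
- split; last by split.
  rewrite /ruin_profile add0r expr0n/= subr0.
  have a1 : 2 * c <= dl * L / 2 / (dl * L / 2 + 2 * L + C).
    rewrite ler_pdivlMr; last by nra.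
    apply: (@le_trans _ _ (2 * c * (dl * L / 2 + 3 * L))).
      by rewrite ler_pM2l; lra.
    rewrite [leLHS](_ : _ = dl * L / 4); last first.
      by rewrite /c; field; rewrite gt_eqF//; lra.
    have : 0 <= dl * L by rewrite mulr_ge0//; lra.
    lra.
  have k0 : 0 <= 1 - s2 / M ^+ 2 by rewrite subr_ge0 ler_pdivrMr ?mul1r.
  have x0 : 0 <= s2 / M ^+ 2 by rewrite divr_ge0 ?ltW.
  have x1 : s2 / M ^+ 2 <= 1 by lra.
  have := bernoulli_decay N x0 x1; set k := (1 - _) ^+ N => kN.
  have k0' : 0 <= k by exact: exprn_ge0.
  suff : k * M ^+ 2 <= c by rewrite -/M; lra.
  have H : M ^+ 2 / c <= N%:R * (s2 / M ^+ 2).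
    rewrite mulrA ler_pdivlMr// -ler_pdivrMr//.
    apply: le_trans (ltW N1); rewrite le_eqVlt; apply/orP; left; apply/eqP.
    by field; rewrite !gt_eqF.
  have : k * (M ^+ 2 / c) <= 1.
    apply: le_trans kN; rewrite ler_wpM2l//; lra.
  by rewrite mulrA ler_pdivrMr// mul1r.
Qed.

End valley_of_climbs.

(** * The steps of the potential are centred and not degenerate *)

Section moments.
Context (R : realType) (dOm : measure_display) (Om : measurableType dOm)
  (P : probability Om R) (X : {RV P >-> R}) (eps : R).
Hypothesis X01 : forall o, 0 < X o < 1.
Hypothesis mean0 : ('E_P[fun o => ln (rho (X o))] = 0)%E.
Hypothesis var_gt0 : (0 < 'V_P[fun o => ln (rho (X o))])%E.
Hypothesis eps01 : 0 < eps < 2^-1.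
Hypothesis ell : P [set o | eps <= X o <= 1 - eps] = 1%E.

Let g := clipped_log_rho eps.
Let mu : probability R R := distribution P X.

Let mln1 : measurable_fun setT (fun p : R => ln (1 - p) - ln p).
Proof.
apply: measurable_funB; last exact: measurable_ln.
apply: (measurableT_comp (@measurable_ln R)).
exact: measurable_funB.
Qed.

Lemma measurable_clipped_log_rho : measurable_fun setT g.
Proof.
apply: measurable_fun_ifT => //; apply: measurable_and.
  exact: measurable_fun_ler.
apply: measurable_fun_ler => //; exact: measurable_funB.
Qed.

Let mX : measurable_fun setT X.
Proof. exact: measurable_funP. Qed.

Let gE o : ln (rho (X o)) = ln (1 - X o) - ln (X o).
Proof.
by have /andP[p0 p1] := X01 o; rewrite /rho ln_div ?posrE// subr_gt0.
Qed.

Let g_ae : {ae P, forall o, ln (rho (X o)) = g (X o)}.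
Proof.
have mell : measurable [set o | eps <= X o <= 1 - eps].
  rewrite (_ : [set o | _] = X @^-1` [set` `[eps, 1 - eps]]).
    by rewrite -[Y in measurable Y]setTI; apply: mX => //; exact: measurable_itv.
  by apply/seteqP; split => o; rewrite /= in_itv.
exists (~` [set o | eps <= X o <= 1 - eps]); split.
- exact: measurableC.
- by rewrite probability_setC// ell subee.
- move=> o /= no /=; apply: contra_not no => h.
  by rewrite /g clipped_log_rhoE//; case/andP: eps01.
Qed.

Let g_bound x : `|g x| <= - ln eps.
Proof. exact: clipped_log_rho_le. Qed.

Let measurable_sqr : measurable_fun setT (fun x => g x ^+ 2).
Proof. by apply: measurable_funX; exact: measurable_clipped_log_rho. Qed.

Let sqr_bound x : `|g x ^+ 2| <= (- ln eps) ^+ 2.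
Proof. by rewrite normrX lerXn2r// nnegrE (le_trans _ (g_bound x)). Qed.

Lemma mean_clipped_log_rho : (\int[mu]_x g x)%R = 0.
Proof.
rewrite /Rintegral integral_distribution.
- rewrite (ae_eq_integral (EFin \o (fun o => ln (rho (X o))))) //.
  + by move: mean0; rewrite unlock => ->.
  + apply/measurable_EFinP; apply: measurableT_comp mX.
    exact: measurable_clipped_log_rho.
  + apply/measurable_EFinP; rewrite (_ : (fun o => _) = fun o => ln (1 - X o) - ln (X o)).
      exact: measurableT_comp mln1 mX.
    by apply/funext => o; exact: gE.
  + by apply: filterS g_ae => o go _ /=; rewrite go.
- by apply/measurable_EFinP; exact: measurable_clipped_log_rho.
- apply: (@integrable_bounded _ _ _ _ (g \o X) (- ln eps)).
    exact: measurableT_comp measurable_clipped_log_rho mX.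
  by move=> x; exact: g_bound.
Qed.

Lemma var_clipped_log_rho_gt0 : 0 < (\int[mu]_x (g x ^+ 2))%R.
Proof.
have fin : (\int[mu]_x (g x ^+ 2)%:E)%E \is a fin_num.
  apply: integrable_fin_num => //.
  exact: (integrable_bounded mu measurable_sqr sqr_bound).
rewrite -lte_fin /Rintegral fineK//; apply: lt_le_trans var_gt0 _.
rewrite /variance unlock mean0 /= unlock ge0_integral_distribution; last 2 first.
- by apply/measurable_EFinP.
- by move=> y; rewrite lee_fin sqr_ge0.
rewrite le_eqVlt; apply/orP; left; apply/eqP.
have ml : measurable_fun setT (fun o => ln (rho (X o))).
  rewrite (_ : (fun o => _) = fun o => ln (1 - X o) - ln (X o)).
    exact: measurableT_comp mln1 mX.
  by apply/funext => o; exact: gE.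
apply: ae_eq_integral => //.
- apply/measurable_EFinP; apply: measurable_funM; apply: measurable_funB => //.
- by apply/measurable_EFinP; exact: measurableT_comp measurable_sqr mX.
- apply: filterS g_ae => o go _ /=; rewrite -go expr2.
  by rewrite /GRing.mul /= !subr0.
Qed.

End moments.

(** * Almost every tuple of environments has infinitely many common valleys *)

Section product_space.
Context (dOm : measure_display) (Om : measurableType dOm) (R : realType)
  (P : probability Om R) (d : nat).

Lemma measurable_all_tnth (B : set Om) : measurable B ->
  measurable [set w : d.-tuple Om | forall k, B (tnth w k)].
Proof. by move=> mB; exact: (@measurable_rectangle _ _ d (fun=> B)). Qed.

Lemma product_prob_all_tnth (B : set Om) : measurable B ->
  product_prob P d [set w | forall k, B (tnth w k)] = (\prod_(k < d) P B)%E.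
Proof. by move=> mB; exact: (product_probE P (fun=> mB)). Qed.

Lemma ae_product_all_tnth (B : set Om) : measurable B -> P B = 1%E ->
  {ae product_prob P d, forall w, forall k, B (tnth w k)}.
Proof.
move=> mB PB; have mT := measurable_all_tnth mB.
exists (~` [set w : d.-tuple Om | forall k, B (tnth w k)]); split => //.
- exact: measurableC.
- apply: (eq_trans (probability_setC (product_prob P d) mT)).
  by rewrite product_prob_all_tnth// big1 ?subee.
Qed.

(** Events that are independent under P stay so when they are required of all
    coordinates at once, and their probability is raised to the power d. *)
Lemma product_second_borel_cantelli (B : nat -> set Om) (c : R) :
  (forall j, measurable (B j)) ->
  (forall J : seq nat, uniq J ->
     P [set o | forall j, j \in J -> B j o] = (\prod_(j <- J) P (B j))%E) ->
  0 < c -> (forall j, (c%:E <= P (B j))%E) ->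
  {ae product_prob P d, forall w, forall m,
     exists2 j, (m <= j)%N & forall k, B j (tnth w k)}.
Proof.
move=> mB indB c0 cB.
apply: (@second_borel_cantelli _ _ _ _
  (fun j => [set w : d.-tuple Om | forall k, B j (tnth w k)]) _ _ (c ^+ d)).
- by move=> j; exact: measurable_all_tnth.
- move=> J uJ; pose BJ := [set o | forall j, j \in J -> B j o].
  have mBJ : measurable BJ.
    rewrite (_ : BJ = \bigcap_(j in [set j | j \in J]) B j)//.
    by apply: bigcap_measurableType => j _.
  rewrite (_ : [set t | _] = [set w : d.-tuple Om | forall k, BJ (tnth w k)]).
    rewrite product_prob_all_tnth// indB// exchange_big/=.
    by apply: eq_bigr => j _; rewrite product_prob_all_tnth.
  by apply/seteqP; split => w h; [move=> k j jJ|move=> j jJ k]; exact: h.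
- exact: exprn_gt0.
- move=> j; rewrite product_prob_all_tnth//.
  have PE : P (B j) = (fine (P (B j)))%:E by rewrite fineK// fin_num_measure.
  have pc : c <= fine (P (B j)) by rewrite -lee_fin -PE.
  rewrite PE prodEFin lee_fin prodr_const card_ord.
  by rewrite lerXn2r// nnegrE ?fine_ge0// ltW.
Qed.

End product_space.

Section environment.
Context (R : realType) (dOm : measure_display) (Om : measurableType dOm)
  (P : probability Om R) (omega : int -> {RV P >-> R}) (eps : R) (d : nat).
Hypothesis d_gt0 : (0 < d)%N.
Hypothesis omega01 : forall x o, 0 < omega x o < 1.
Hypothesis omega_iid : iid omega.
Hypothesis mean_log_rho : ('E_P[fun o => ln (rho (omega 0%R o))] = 0)%E.
Hypothesis var_log_rho : (0 < 'V_P[fun o => ln (rho (omega 0%R o))])%E.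
Hypothesis eps_bounds : 0 < eps < 2^-1.
Hypothesis elliptic : P [set o | eps <= omega 0 o <= 1 - eps] = 1%E.

Let mu : probability R R := distribution P (omega 0).

Let law x A : measurable A -> P (omega x @^-1` A) = mu A.
Proof. by move=> mA; case: omega_iid => _ /(_ x 0 A mA). Qed.

Lemma ae_elliptic : {ae product_prob P d, forall w, forall k x,
  eps <= omega x (tnth w k) <= 1 - eps}.
Proof.
have E x : {ae product_prob P d, forall w, forall k,
    eps <= omega x (tnth w k) <= 1 - eps}.
  have eE y : [set o | eps <= omega y o <= 1 - eps] = omega y @^-1` [set` `[eps, 1 - eps]].
    by apply/seteqP; split => o; rewrite /= in_itv.
  apply: (@ae_product_all_tnth _ _ _ _ _ [set o | eps <= omega x o <= 1 - eps]).
    rewrite eE -[Y in measurable Y]setTI.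
    by apply: measurable_funP => //; exact: measurable_itv.
  rewrite eE law; last exact: measurable_itv.
  by rewrite -elliptic eE.
have E1 n := E n%:Z; have E2 n := E (Negz n).
apply: filterS2 (ae_foralln E1) (ae_foralln E2) => w h1 h2 k [n|n].
  exact: h1.
exact: h2.
Qed.

(** The scales are chosen one after the other: the block of scale j starts at
    distance rr j from the origin, where [scale_exists] gives its scale L and
    its number N of sites on each side. The even block 2 j lies on the left, the
    odd block 2 j + 1 on the right. *)
Lemma ae_valleys : {ae product_prob P d, forall w,
  (forall k x, eps <= omega x (tnth w k) <= 1 - eps) ->
  forall m : R, exists2 L, m <= L &
    forall k, has_valley (fun x => omega x (tnth w k)) (L / (4 * d%:R)) L}.
Proof.
pose dl : R := (4 * d%:R)^-1.
have d1 : 1 <= d%:R :> R by rewrite ler1n.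
have dl0 : 0 < dl by rewrite invr_gt0; lra.
have dl1 : dl <= 1 by rewrite invf_le1; lra.
pose C := - ln eps; pose g := clipped_log_rho eps.
have C0 : 0 <= C by apply: le_trans (clipped_log_rho_le 0 eps_bounds).
pose s2 := (\int[mu]_x (g x ^+ 2))%R.
have s20 : 0 < s2 by exact: var_clipped_log_rho_gt0.
have dl01 : 0 < dl <= 1 by rewrite dl0.
have /choice[LN HLN] : forall r : nat, exists p : R * nat,
    [/\ (r%:R + 1 <= p.1), (0 < p.2)%N, C * r%:R <= dl * p.1 / 2,
    (2 * (r + p.2)).+1%:R <= expR (dl * p.1) &
    dl / (4 * (dl + 6)) <= ruin_profile C s2 (dl * p.1 / 2) (2 * p.1)
      (2 * p.1 + C + 1) p.2 0
    /\ s2 <= (2 * p.1 + C + 1) ^+ 2 /\ C <= p.1].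
  by move=> r; have [L [N H]] := scale_exists r C0 s20 dl01; exists (L, N).
pose rr j := iter j (fun r => r + (LN r).2)%N 0%N.
have rrS j : rr j.+1 = (rr j + (LN (rr j)).2)%N by [].
have rr_le i j : (i <= j)%N -> (rr i <= rr j)%N.
  elim: j => [|j IH]; first by rewrite leqn0 => /eqP ->.
  by rewrite leq_eqVlt => /orP[/eqP ->//|/IH h]; rewrite rrS; lia.
have rr_ge j : (j <= rr j)%N.
  by elim: j => // j IH; rewrite rrS; have [_ + _ _ _] := HLN (rr j); lia.
pose n b := (LN (rr b./2)).2; pose L b := (LN (rr b./2)).1.
pose f b i := site (odd b) (rr b./2 + i).
have rr_lt b i b' i' : (i < n b)%N -> (i' < n b')%N ->
    (rr b./2 + i = rr b'./2 + i')%N -> b./2 = b'./2.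
  rewrite /n => ib ib' E; case: (ltngtP b./2 b'./2) => // /rr_le; rewrite rrS; lia.
have f_inj b i b' i' : (i < n b)%N -> (i' < n b')%N ->
    f b i = f b' i' -> b = b' /\ i = i'.
  move=> ib ib' E.
  have [ob E2] : odd b = odd b' /\ (rr b./2 + i = rr b'./2 + i')%N.
    move: E; rewrite /f /site; case: (odd b); case: (odd b') => E; split => //; lia.
  have hb := rr_lt _ _ _ _ ib ib' E2.
  have bb : b = b' by rewrite -(odd_double_half b) -(odd_double_half b') ob hb.
  by split => //; move: E2; rewrite hb; lia.
pose gs s p := side_sign R s * g p.
pose D b : set ((n b).-tuple R) :=
  [set t | climbs (gs (odd b)) (dl * L b / 2) (2 * L b) 0 t].
have mgs s : measurable_fun setT (gs s).
  by apply: measurable_funM => //; exact: measurable_clipped_log_rho.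
have mD b : measurable (D b) by exact: measurable_climbs_from.
pose c := dl / (4 * (dl + 6)).
have c0 : 0 < c by rewrite divr_gt0//; lra.
have cD b : (c%:E <= product_prob mu (n b) (D b))%E.
  have [Lr _ _ _ [prof [s2M CL]]] := HLN (rr b./2).
  rewrite climb_probE// lee_fin; apply: le_trans prof _.
  have gC x : `|gs (odd b) x| <= C.
    rewrite /gs normrM; have := clipped_log_rho_le x eps_bounds.
    by case: (odd b); rewrite /= ?normrN normr1 mul1r.
  have g_mean : (\int[mu]_x gs (odd b) x)%R = 0.
    rewrite (RintegralZl _ measurableT) ?mean_clipped_log_rho ?mulr0//.
    apply: integrable_bounded; first exact: measurable_clipped_log_rho.
    by move=> x; exact: clipped_log_rho_le.
  have g_var : (\int[mu]_x (gs (odd b) x ^+ 2))%R = s2.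
    apply: eq_Rintegral => x _; rewrite /gs exprMn.
    by case: (odd b); rewrite /= ?sqrrN expr1n mul1r.
  have L0 : 0 <= dl * L b by rewrite mulr_ge0//; rewrite /L; lra.
  have LdL : dl * L b <= L b by rewrite ler_piMl//; rewrite /L; lra.
  have L1 : 1 <= L b by apply: le_trans Lr; rewrite lerDr.
  move: s2M CL; rewrite -/(L b) => s2M CL.
  apply: (climb_prob_ge_profile (mgs _) gC g_mean g_var) => //; try lra.
pose blk := block omega f n.
pose BJ (J : seq nat) := [set o | forall b, b \in J -> D b (blk b o)].
have PBJ J : uniq J -> P (BJ J) = (\prod_(b <- J) product_prob mu (n b) (D b))%E.
  move=> uJ; case: omega_iid => indep _.
  have := prob_block_event indep law f_inj uJ (isT : uniq [::]) mD
    (fun x (xn : x \in [::]) => measurableT) (fun _ _ _ _ => isT).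
  rewrite big_nil mule1 => <-; congr (P _); apply/seteqP; split => o.
    by move=> h; split.
  by case.
have mBJ J : measurable (BJ J).
  rewrite (_ : BJ J = \bigcap_(b in [set b | b \in J]) (blk b @^-1` D b))//.
  apply: bigcap_measurableType => b _; rewrite -[Y in measurable Y]setTI.
  exact: (@measurable_block _ _ _ _ _ P _ omega f n b measurableT _ (mD b)).
(* Scale j needs a climb on both sides, that is in the blocks 2 j and 2 j + 1. *)
pose both (J : seq nat) := [seq j.*2 | j <- J] ++ [seq j.*2.+1 | j <- J].
have uboth J : uniq J -> uniq (both J).
  move=> uJ; rewrite cat_uniq !map_inj_uniq ?uJ//=; last 2 first.
  - by move=> i j [] /double_inj.
  - exact: double_inj.
  rewrite andbT; apply/hasPn => b /mapP[i _ ->]; apply/mapP => -[j _].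
  by move=> /(congr1 odd); rewrite /= !odd_double.
have Pboth J : uniq J -> P (BJ (both J)) = (\prod_(j <- J) P (BJ (both [:: j])))%E.
  move=> uJ; rewrite PBJ ?uboth// big_cat/= !big_map -big_split/=.
  by apply: eq_bigr => j _; rewrite PBJ ?uboth// !big_cons big_nil mule1.
have often : {ae product_prob P d, forall w, forall m,
    exists2 j, (m <= j)%N & forall k, BJ (both [:: j]) (tnth w k)}.
  apply: (@product_second_borel_cantelli _ _ _ P d (fun j => BJ (both [:: j])) (c * c)).
  - by move=> j; exact: mBJ.
  - move=> J uJ; rewrite -Pboth//; congr (P _); apply/seteqP; split => o.
      move=> h b; rewrite mem_cat => /orP[] /mapP[j jJ ->]; apply: (h j jJ).
        by rewrite inE eqxx.
      by rewrite !inE eqxx orbT.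
    move=> h j jJ b; rewrite !inE => /orP[] /eqP ->; apply: h; rewrite mem_cat.
      by rewrite map_f.
    by rewrite map_f ?orbT.
  - exact: mulr_gt0.
  - move=> j; rewrite PBJ ?uboth// !big_cons big_nil mule1 EFinM.
    by apply: lee_pmul; rewrite ?lee_fin ?(ltW c0)//; exact: cD.
apply: filterS often => w hw ell m.
(* The scale L of step j exceeds rr j >= j, hence m for some such j. *)
have [j mj hj] := hw (Num.truncn m).+1.
have [Lr N0 CL wid _] := HLN (rr j).
set Lj := (LN (rr j)).1 in Lr CL wid *; set N := (LN (rr j)).2 in N0 wid *.
exists Lj.
  have : m < (Num.truncn m).+1%:R := truncnS_gt m.
  have : (Num.truncn m).+1%:R <= (rr j)%:R :> R by rewrite ler_nat (leq_trans mj).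
  by lra.
move=> k.
have climb b : b \in both [:: j] -> climbs (gs (odd b)) (dl * L b / 2) (2 * L b) 0
    [seq omega (site (odd b) (rr b./2 + i)) (tnth w k) | i <- iota 0 (n b)].
  move=> bj; have : D b (blk b (tnth w k)) := hj k b bj.
  rewrite /D /=; congr (climbs _ _ _ _ _).
  by rewrite -val_enum_ord -map_comp.
have climbj s : climbs (gs s) (dl * Lj / 2) (2 * Lj) 0
    [seq omega (site s (rr j + i)) (tnth w k) | i <- iota 0 N].
  case: s; [have := climb j.*2.+1|have := climb j.*2];
    rewrite /L /n /both /= ?uphalf_double ?doubleK odd_double /=; apply;
    by rewrite !inE eqxx ?orbT.
have Lj1 : 1 <= Lj by apply: le_trans Lr; rewrite lerDr.
have dlL : dl * Lj <= Lj by rewrite ler_piMl//; lra.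
have dlL0 : 0 <= dl * Lj by rewrite mulr_ge0//; lra.
apply: (@valley_of_climbs R _ eps C (rr j) N (dl * Lj / 2) (2 * Lj)) => //.
- by lra.
- by rewrite [leRHS]mulrC -/dl; lra.
- by lra.
- by rewrite [X in expR X]mulrC.
Qed.

End environment.

(** * Divergence and simultaneous recurrence *)

Theorem corollary1p4 (R : realType) (dOm : measure_display)
    (Om : measurableType dOm) (P : probability Om R)
    (omega : int -> {RV P >-> R}) (eps : R) (d : nat)
    (d_gt0 : (0 < d)%N)
    (omega01 : forall x o, 0 < omega x o < 1)
    (omega_iid : iid omega)
    (mean_log_rho : ('E_P[fun o => ln (rho (omega 0%R o))] = 0)%E)
    (var_log_rho : (0 < 'V_P[fun o => ln (rho (omega 0%R o))])%E)
    (eps_bounds : 0 < eps < 2^-1)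
    (elliptic : P [set o | eps <= omega 0 o <= 1 - eps] = 1%E) :
  (\forall w \ae product_prob P d,
     forall (dT : 'I_d -> measure_display)
       (T : forall k, measurableType (dT k))
       (Q : forall k, probability (T k) R)
       (X : forall k, nat -> {RV (Q k) >-> int}),
       (forall k, is_rwre (fun x => omega x (tnth w k)) (X k)) ->
       (\sum_(1 <= n <oo)
          \prod_(k < d) Q k [set t | X k n.*2 t = 0%R] = +oo)%E)
  /\
  (\forall w \ae product_prob P d,
     forall (dT : measure_display) (T : measurableType dT)
       (Q : probability T R) (X : 'I_d -> nat -> {RV Q >-> int}),
       (forall k, is_rwre (fun x => omega x (tnth w k)) (X k)) ->
       independent_processes X ->
       \forall t \ae Q, infinite_set [set n | forall k, X k n t = 0]).
Proof.
have diverge : {ae product_prob P d, forall w,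
  (\sum_(1 <= n <oo) \prod_(k < d)
     (return_prob (fun x => omega x (tnth w k)) n.*2 0)%:E = +oo)%E}.
  have := ae_valleys d_gt0 omega01 omega_iid mean_log_rho var_log_rho eps_bounds elliptic.
  apply: filterS2 (ae_elliptic d omega_iid elliptic) => w ell val.
  apply: (@sum_return_pinfty _ _ _ eps) => //; first by case/andP: eps_bounds.
  exact: val.
split; apply: filterS diverge => w sumoo.
  move=> dT T Q X rwX; rewrite -[RHS]sumoo; apply: eq_eseriesr => n _.
  by apply: eq_bigr => k _; exact: rwre_return_prob.
move=> dT T Q X rwX indX; apply: (joint_recurrent rwX indX).
rewrite -[RHS]sumoo; apply: eq_eseriesr => n _.
by apply: eq_bigr => k _; exact: rwre_return_prob.
Qed.
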